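(* Let $(\mathbf d_n)_n$ be graphical degree sequences such that $\mathbf d_n$ is $(m_0,Q_0)$-subcritical for some parameters $m_0=m_0(n)\ge0$ and $Q_0=Q_0(n)\le0$ satisfying $$m_0\ge3m_*,\qquad m_0|Q_0|\ge(\Delta|Q_0|+R)\log\left(\frac{nQ_0^2}{\Delta|Q_0|+R}\right),\qquad Q_0^2n\ge\omega(n)m_0$$ for some $\omega(n)\to\infty$. Then $$\mathbb P\left(L_1(\mathbb G_n(\mathbf d_n))=O(m_0/|Q_0|)\right)=1-o(1)\quad(n\to\infty),$$ that is, there is a constant $C>0$ not depending on $n$ such that $\mathbb P\left(L_1(\mathbb G_n(\mathbf d_n))\le Cm_0/|Q_0|\right)\to1$.
   Context: Asymptotics are as $n\to\infty$. For each $n$, $\mathbf d_n=(d_1,\dots,d_n)$ is a degree sequence on $[n]=\{1,\dots,n\}$ with integers $1\le d_1\le\dots\le d_n$ and $m=\sum_{i\in[n]}d_i$ even; $\Delta=d_n$ is the maximum degree and $R=\frac1m\sum_{i\in[n]}d_i(d_i-2)^2$. The sequence is graphical if some simple graph on $[n]$ has vertex $i$ of degree $d_i$ for all $i$. The uniform model $\mathbb G_n=\mathbb G_n(\mathbf d_n)$ is a uniformly random simple graph among all simple graphs on $[n]$ in which vertex $i$ has degree $d_i$ for all $i$. $L_1(G)$ is the order (number of vertices) of a largest connected component of $G$. Let $S_*$ be a smallest set of vertices of largest degree (i.e. consisting of the vertices of highest degrees) satisfying $\sum_{u\in[n]\setminus S_*}d_u(d_u-2)\le0$, and let $m_*=\sum_{v\in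 S_*}d_v$. For $m_0\ge0$ and $Q_0\le0$, $\mathbf d_n$ is called $(m_0,Q_0)$-subcritical if there exists $S\subseteq[n]$ with $\sum_{v\in S}d_v\le m_0$ and $\frac1m\sum_{w\in[n]\setminus S}d_w(d_w-2)\le Q_0$.
   Formalization: Adds the hypothesis Δ ≤ m_0 for large n, since the claim fails otherwise (e.g. all degrees 1, Q_0 = -1/√n, m_0 = 1/n); it is automatic if S_* is non-empty or the logarithm's argument is at least e. *)

(* Defs.v *)
From HB Require Import structures.
From mathcomp Require Import all_boot all_order all_algebra.
From mathcomp Require Import all_classical all_reals all_analysis.

Set Implicit Arguments.
Unset Strict Implicit.
Unset Printing Implicit Defensive.

Import Order.TTheory GRing.Theory Num.Theory.
Import numFieldNormedType.Exports.

Local Open Scope ring_scope.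

(* The degree sequence (d_1, ..., d_n) is a function on 'I_n, the vertex i of
   {1, ..., n} being the ordinal i - 1. *)

Definition degsum n (d : 'I_n -> nat) : nat := (\sum_i d i)%N.

Definition is_degree_sequence n (d : 'I_n -> nat) : Prop :=
  [/\ forall i, (1 <= d i)%N,
      forall i j : 'I_n, (i <= j)%N -> (d i <= d j)%N
    & ~~ odd (degsum d)].

Definition maxdeg n (d : 'I_n -> nat) : nat := (\max_i d i)%N.

(* The parameter R of the degree sequence, valued in the real field K. *)
Definition Rparam (K : realType) n (d : 'I_n -> nat) : K :=
  (\sum_i (d i)%:R * ((d i)%:R - 2) ^+ 2) / (degsum d)%:R.

(* An integer, since d_u - 2 is negative for d_u = 1. *)
Definition excess n (d : 'I_n -> nat) (A : {set 'I_n}) : int :=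
  \sum_(u in A) (d u)%:Z * ((d u)%:Z - 2).

Definition highest_degrees n (d : 'I_n -> nat) (S : {set 'I_n}) : bool :=
  [forall u in S, forall v in ~: S, (d v <= d u)%N].

(* The full vertex set is always a candidate.  Vertices of equal degree make
   the minimizer non-unique, but not its degree sum. *)
Definition Sstar n (d : 'I_n -> nat) : {set 'I_n} :=
  [arg min_(S < [set: 'I_n] | highest_degrees d S && (excess d (~: S) <= 0)%R)
     #|S|]%N.

Definition mstar n (d : 'I_n -> nat) : nat := (\sum_(v in Sstar d) d v)%N.

Definition subcritical (K : realType) n (d : 'I_n -> nat) (m0 Q0 : K) : Prop :=
  [/\ 0 <= m0, Q0 <= 0
    & exists S : {set 'I_n},
        (\sum_(v in S) d v)%N%:R <= m0 /\
        (excess d (~: S))%:~R / (degsum d)%:R <= Q0].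

(* A graph on [n] is given by its set of edges, which are sets of vertices. *)
Definition simple_graph n (G : {set {set 'I_n}}) : bool :=
  [forall e in G, #|e| == 2%N].

Definition degree n (G : {set {set 'I_n}}) (v : 'I_n) : nat :=
  #|[set e in G | v \in e]|.

Definition adj n (G : {set {set 'I_n}}) : rel 'I_n :=
  fun u v => [set u; v] \in G.

Definition L1 n (G : {set {set 'I_n}}) : nat :=
  (\max_(v : 'I_n) #|[set u | connect (adj G) v u]|)%N.

Definition realizations n (d : 'I_n -> nat) : {set {set {set 'I_n}}} :=
  [set G | simple_graph G && [forall v, degree G v == d v]].

Definition graphical n (d : 'I_n -> nat) : Prop :=
  exists G : {set {set 'I_n}}, G \in realizations d.

(* The probability of E under the uniform law on the realizations of d. *)
Definition unifprob (K : realType) n (d : 'I_n -> nat)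
    (E : pred {set {set 'I_n}}) : K :=
  #|[set G in realizations d | E G]|%:R / #|realizations d|%:R.

(* Main.v *)
Require Import Defs.
From HB Require Import structures.
From mathcomp Require Import all_boot all_order all_algebra.

(* The component of a set A_0 of vertices is explored one edge at a time: given
   the set E of edges revealed so far, the graph is uniform among the realizations
   that contain E. If S is a set of highest-degree vertices contained in A_0, then
   replacing two edges uw, vz by uv, wz, for v an unexplored vertex of degree 1,
   compares the probability that the next edge at u leads to w, for w outside S,
   with d_w times the average probability that it leads to such a leaf. The relative
   error is at most (c + c^2 + d(S)) over the number of unexplored leaves, c being
   the maximum degree outside S; for S of degree sum about 20 m_0 the hypothesis
   m_0 >= 3 m_* makes c(c+1) small compared with q = - sum_(w notin S) d_w(d_w-2),
   so the number of half-edges still to be explored has drift at most - q / (4 m)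
   per edge, and q >= m |Q_0|.

   Let D = Delta |Q_0| + R and y = n Q_0^2 / D. When y is large, an exponential
   supermartingale bounds by y^-2 the probability that the component of S + v has
   more than a constant times m_0 / |Q_0| vertices, and a union bound over v, divided
   by the size of the component, concludes. When y is bounded, the logarithmic
   hypothesis is void, but then m_0^2 / m tends to infinity; the component of S is
   then treated by the exponential bound, and every other component by the linear
   supermartingale, started from the d_v half-edges of v after the component of S has
   been exposed. *)

Set Implicit Arguments.
Unset Strict Implicit.
Unset Printing Implicit Defensive.

Import Order.TTheory GRing.Theory Num.Theory.

Local Open Scope nat_scope.

(** * Realizations containing given edges *)

Section Graphs.
Variables (n : nat) (d : 'I_n -> nat).
Implicit Types (G E : {set {set 'I_n}}) (A S : {set 'I_n}) (u v w z : 'I_n).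

Definition nbrs G v : {set 'I_n} := [set w | adj G v w].

Definition extensions E : {set {set {set 'I_n}}} :=
  [set G in realizations d | E \subset G].

Lemma adjC G u v : adj G u v = adj G v u.
Proof. by rewrite /adj setUC. Qed.

Lemma set2_inj u v w : [set u; v] = [set u; w] -> v = w.
Proof.
move=> /setP eq; move: (eq v) (eq w); rewrite !inE !eqxx !orbT.
by move=> /esym/orP[/eqP->|/eqP->] // /orP[] /eqP->.
Qed.

Lemma adj_neq G u v : simple_graph G -> adj G u v -> u != v.
Proof.
move=> /forall_inP sG uv; apply/eqP => eq_uv; move: (sG _ uv).
by rewrite eq_uv setUid cards1.
Qed.

Lemma degree_nbrs G v : simple_graph G -> degree G v = #|nbrs G v|.
Proof.
move=> sG; rewrite /degree.
have -> : [set e in G | v \in e] = [set [set v; w] | w in nbrs G v].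
  apply/setP => e; rewrite !inE; apply/andP/imsetP => [[eG ve]|[w]].
    have /cards2P[x [y [xy def_e]]] := forall_inP sG _ eG.
    move: ve eG; rewrite def_e !inE => /orP[]/eqP-> eG.
      by exists y; rewrite ?inE.
    by exists x; [rewrite inE /adj setUC | rewrite setUC].
  by rewrite inE => vw ->; split => //; rewrite !inE eqxx.
rewrite card_in_imset // => w1 w2 _ _; exact: set2_inj.
Qed.

Lemma extensionsP E G : reflect
  [/\ simple_graph G, forall v, degree G v = d v & E \subset G]
  (G \in extensions E).
Proof.
rewrite !inE; apply: (iffP andP) => [[/andP[-> /forallP dG] ->]|[-> dG ->]].
  by split=> // v; exact/eqP.
by split=> //; apply/forallP => v; rewrite dG.
Qed.

Lemma nbrs_card E G v : G \in extensions E -> #|nbrs G v| = d v.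
Proof. by move=> /extensionsP[sG dG _]; rewrite -degree_nbrs. Qed.

Lemma extensionsU1 E G e :
  (G \in extensions (e |: E)) = (G \in extensions E) && (e \in G).
Proof. by rewrite !inE subUset sub1set -!andbA; do !bool_congr. Qed.

Lemma degree_le E G v : E \subset G -> degree E v <= degree G v.
Proof.
move=> EG; apply: subset_leq_card; apply/subsetP => e; rewrite !inE.
by move=> /andP[/(subsetP EG)-> ->].
Qed.

Lemma degree_ext_le E G v : G \in extensions E -> degree E v <= d v.
Proof. by move=> /extensionsP[_ <- EG]; exact: degree_le. Qed.

Lemma degreeU1 E e v : e \notin E ->
  degree (e |: E) v = (v \in e) + degree E v.
Proof.
move=> eE; rewrite /degree; case: (boolP (v \in e)) => ve.
  rewrite (_ : [set _ in _ | _] = e |: [set f in E | v \in f]).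
    by rewrite cardsU1 inE (negPf eE).
  by apply/setP => f; rewrite !inE; case: eqP => // ->; rewrite ve.
rewrite add0n; apply: eq_card => f; rewrite !inE.
by case: eqP => // ->; rewrite (negPf ve) !andbF.
Qed.

Lemma degreeD1 E e v : e \in E ->
  degree E v = (v \in e) + degree (E :\ e) v.
Proof. by move=> eE; rewrite -degreeU1 ?setD1K // !inE eqxx. Qed.

Lemma unrevealed_card E G u : G \in extensions E ->
  #|[set w | ([set u; w] \in G) && ([set u; w] \notin E)]| = d u - degree E u.
Proof.
move=> /extensionsP[sG <- EG].
have sGE : simple_graph (G :\: E).
  by apply/forall_inP => e /setDP[/(forall_inP sG)].
transitivity (degree (G :\: E) u).
  rewrite degree_nbrs //.
  by apply: eq_card => w; rewrite !inE /adj !inE andbC.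
rewrite /degree (_ : [set e in G :\: E | _] =
  [set e in G | u \in e] :\: [set e in E | u \in e]).
  rewrite cardsDS //; apply/subsetP => e; rewrite !inE => /andP[/(subsetP EG)->].
  by [].
by apply/setP => e; rewrite !inE; do !case: (_ \in _).
Qed.

(** Double counting of the pairs (G, w) with [uw] an unrevealed edge of G: each G containing [E] has
    exactly [d u - degree E u] such w. It plays the part of the law of total probability for a
    uniformly chosen next edge at [u]. *)
Lemma reveal_sum E u (P : pred {set {set 'I_n}}) :
  \sum_(w | [set u; w] \notin E) #|[set G in extensions ([set u; w] |: E) | P G]|
  = (d u - degree E u) * #|[set G in extensions E | P G]|.
Proof.
have cardE w : #|[set G in extensions ([set u; w] |: E) | P G]| =
    \sum_(G in [set G in extensions E | P G]) ([set u; w] \in G).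
  rewrite -big_mkcondr /= sum1dep_card; apply: eq_card => G.
  rewrite in_set extensionsU1 [RHS]in_set [in RHS]in_set.
  by rewrite -!andbA; congr (_ && _); rewrite andbC.
under eq_bigr do rewrite cardE.
rewrite exchange_big /= mulnC -sum_nat_const.
apply: eq_bigr => G; rewrite inE => /andP[GE _].
rewrite -(unrevealed_card u GE) -big_mkcondr /= sum1dep_card.
by apply: eq_card => w; rewrite !inE andbC.
Qed.

Lemma reveal_sum1 E u :
  \sum_(w | [set u; w] \notin E) #|extensions ([set u; w] |: E)|
  = (d u - degree E u) * #|extensions E|.
Proof.
have -> : extensions E = [set G in extensions E | xpredT G].
  by apply/setP => G; rewrite !inE andbT.
rewrite -reveal_sum; apply: eq_bigr => w _; apply: eq_card => G.
by rewrite inE andbT.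
Qed.
End Graphs.

(** * Switching *)

Section Switching.
Variables (n : nat) (d : 'I_n -> nat).
Implicit Types (G E : {set {set 'I_n}}) (A S : {set 'I_n}) (u v w z : 'I_n).

Lemma mem_set2 (T : finType) (x a b : T) :
  a != b -> (x \in [set a; b]) = (x == a) + (x == b) :> nat.
Proof.
move=> ab; rewrite !inE; case: eqP => [->|_] //=.
by rewrite (negPf ab).
Qed.

Definition switch u w v z G :=
  [set u; v] |: ([set w; z] |: ((G :\ [set u; w]) :\ [set v; z])).

Lemma nbrs1_eq E G v z1 z2 : G \in extensions d E -> d v = 1 ->
  adj G v z1 -> adj G v z2 -> z1 = z2.
Proof.
move=> GE dv; have /eqP := nbrs_card v GE; rewrite dv => /cards1P[z nz] vz1 vz2.
have : z1 \in nbrs G v by rewrite inE.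
have : z2 \in nbrs G v by rewrite inE.
by rewrite nz !inE => /eqP-> /eqP->.
Qed.

(** For fixed [u], [w], [v], [z] the switching is injective, as the reverse exchange undoes it. The
    result is simple: [z] is the only neighbour of the leaf [v] and differs from [u], so [uv] was
    not an edge, and [wz] was not one by assumption. Edges of [E] survive because they avoid [v] and
    differ from [uw]. *)
Lemma switch_count E A u w v z :
  (forall e, e \in E -> e \subset A) -> u \in A -> v \notin A -> d v = 1 ->
  [set u; w] \notin E ->
  #|[set G in extensions d ([set u; w] |: E) |
       [&& adj G v z, z != w & ~~ adj G w z]]|
   <= #|[set G in extensions d ([set u; v] |: E) | adj G w z]|.
Proof.
move=> EA uA vA dv uwE.
have vE x : [set v; x] \notin E.
  by apply: contra vA => /EA/subsetP; apply; rewrite !inE eqxx.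
set L := [set G in _ | _].
have sw_ok G : G \in L ->
  [/\ G \in extensions d E, [set u; w] \in G, [set v; z] \in G :\ [set u; w],
      [set w; z] \notin G :\ [set u; w] :\ [set v; z] &
      [/\ [set u; v] \notin [set w; z] |: (G :\ [set u; w] :\ [set v; z]),
      u != w, v != z, u != v & w != z]].
  rewrite in_set extensionsU1 => /andP[/andP[GE uw] /and3P[vz zw nwz]].
  have [sG dG EG] := extensionsP d E G GE.
  have neq_uw := adj_neq sG uw; have neq_vz := adj_neq sG vz.
  have neq_uv : u != v by apply: contraNneq vA => <-.
  have neq_uz : u != z by apply: contraNneq nwz => <-; rewrite adjC.
  have neq_vw : v != w by apply: contraNneq nwz => <-.
  have nuv : ~~ adj G u v.
    by apply: contra neq_uz => uv; apply/eqP/(nbrs1_eq GE dv _ vz); rewrite adjC.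
  split=> //.
  - rewrite !inE; apply/andP; split => //.
    apply/negP => /eqP/setP/(_ v); rewrite !inE eqxx /=.
    by rewrite (eq_sym v) (negPf neq_uv) (negPf neq_vw).
  - by rewrite !inE [X in _ && (_ && X)](negPf nwz) !andbF.
  split=> //; last by rewrite eq_sym.
  rewrite !inE [X in _ || _ && (_ && X)](negPf nuv) !andbF orbF.
  apply/negP => /eqP/setP/(_ u); rewrite !inE eqxx /=.
  by rewrite (negPf neq_uw) (negPf neq_uz).
have inj : {in L &, injective (switch u w v z)}.
  pose back G := [set u; w] |: ([set v; z] |: ((G :\ [set u; v]) :\ [set w; z])).
  apply: (@can_in_inj _ _ _ _ back) => G /sw_ok[_ uw vz wz [uv _ _ _ _]].
  by rewrite /back /switch setU1K // setU1K // setD1K // setD1K.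
rewrite -(card_in_imset inj); apply: subset_leq_card.
apply/subsetP => _ /imsetP[G /sw_ok[GE uw vz wz [uv nuw nvz nuv nwz]] ->].
have [sG dG EG] := extensionsP d E G GE.
rewrite in_set extensionsU1 /adj.
have -> : [set u; v] \in switch u w v z G by rewrite !inE eqxx.
have -> : [set w; z] \in switch u w v z G by rewrite !inE eqxx orbT.
rewrite !andbT; apply/extensionsP; split.
- apply/forall_inP => e; rewrite !inE.
  by case/or3P=> [/eqP->|/eqP->|/and3P[_ _ /(forall_inP sG)]] //;
    rewrite cards2 ?nuv ?nwz.
- move=> x; rewrite -dG /switch !degreeU1 // (degreeD1 x uw) (degreeD1 x vz).
  by rewrite !addnA !mem_set2 // (addnACA (x == u)).
- apply/subsetP => e eE; rewrite !inE (subsetP EG _ eE) andbT.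
  have -> : e != [set v; z] by apply: contraNneq (vE z) => <-.
  have -> : e != [set u; w] by apply: contraNneq uwE => <-.
  by rewrite !orbT.
Qed.

(** If a leaf [v] lies outside this set, its neighbour is neither [w] nor adjacent to [w], which is
    what the switching requires. *)
Definition near2 G w : {set 'I_n} :=
  nbrs G w :|: \bigcup_(z in nbrs G w) nbrs G z.

Lemma nbrs_sum E w :
  \sum_z #|[set G in extensions d E | adj G w z]| = d w * #|extensions d E|.
Proof.
have cardE z : #|[set G in extensions d E | adj G w z]| =
    \sum_(G in extensions d E) (adj G w z).
  rewrite -big_mkcondr /= sum1dep_card; apply: eq_card => G.
  by rewrite !in_set.
under eq_bigr do rewrite cardE.
rewrite exchange_big /= mulnC -sum_nat_const; apply: eq_bigr => G GE.
rewrite -(nbrs_card w GE) -big_mkcondr /= sum1dep_card.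
by apply: eq_card => z; rewrite !inE.
Qed.

(** The graphs on the left are sorted by the neighbour [z] of [v]. After the switching [z] is a
    neighbour of [w], so the same graph arises at most [d w] times. *)
Lemma switch_leaf E A u w v :
  (forall e, e \in E -> e \subset A) -> u \in A -> v \notin A -> d v = 1 ->
  [set u; w] \notin E ->
  #|[set G in extensions d ([set u; w] |: E) | v \notin near2 G w]|
   <= d w * #|extensions d ([set u; v] |: E)|.
Proof.
move=> EA uA vA dv uwE; rewrite -nbrs_sum.
pose L z := [set G in extensions d ([set u; w] |: E) |
  [&& adj G v z, z != w & ~~ adj G w z]].
apply: (@leq_trans (\sum_z #|L z|)); last first.
  by apply: leq_sum => z _; exact: (switch_count z EA uA vA dv uwE).
apply: (@leq_trans #|\bigcup_z L z|); last first.
  apply: (big_ind2 (fun (x : {set {set {set 'I_n}}}) y => #|x| <= y)) => //.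
    by rewrite cards0.
  move=> x1 y1 x2 y2 le1 le2; apply: leq_trans (leq_card_setU _ _) _.
  exact: leq_add.
apply: subset_leq_card; apply/subsetP => G; rewrite in_set => /andP[GE nvw].
have /eqP/cards1P[z nz] : #|nbrs G v| = 1 by rewrite (nbrs_card v GE).
have vz : adj G v z by have := set11 z; rewrite -nz inE.
apply/bigcupP; exists z; rewrite // in_set GE vz /=.
move: nvw; rewrite inE negb_or inE => /andP[nwv /bigcupP nb].
apply/andP; split; first by apply: contraNneq nwv => <-; rewrite adjC.
apply/negP => wz; apply: nb; exists z; by rewrite inE // adjC.
Qed.

(** Vertices reached through [S] number at most the degree sum of [S], so the square involves only
    the bound [c] on the degrees outside [S]. *)
Lemma card_near2 E G S w c : G \in extensions d E -> w \notin S ->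
  (forall x, x \notin S -> d x <= c) ->
  #|near2 G w| <= c + c * c + \sum_(s in S) d s.
Proof.
move=> GE wS dc.
have card_cup (B : {set 'I_n}) :
    #|\bigcup_(z in B) nbrs G z| <= \sum_(z in B) d z.
  apply: (big_ind2 (fun (x : {set 'I_n}) y => #|x| <= y)) => //.
  - by rewrite cards0.
  - move=> x1 y1 x2 y2 le1 le2; apply: leq_trans (leq_card_setU _ _) _.
    exact: leq_add.
  - by move=> z _; rewrite (nbrs_card z GE).
rewrite -addnA; apply: leq_trans (leq_card_setU _ _) _.
apply: leq_add; first by rewrite (nbrs_card w GE) dc.
apply: leq_trans (_ : #|\bigcup_(z in nbrs G w :\: S) nbrs G z :|:
   \bigcup_(z in S) nbrs G z| <= _).
  apply: subset_leq_card; apply/bigcupsP => z zw.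
  case: (boolP (z \in S)) => zS; apply/subsetP => x xz; rewrite inE.
    by apply/orP; right; apply/bigcupP; exists z.
  by apply/orP; left; apply/bigcupP; exists z; rewrite // inE zS.
apply: leq_trans (leq_card_setU _ _) _; apply: leq_add (card_cup S).
apply: leq_trans (card_cup _) _.
apply: leq_trans (_ : \sum_(z in nbrs G w :\: S) c <= _).
  by apply: leq_sum => z /setDP[_ /dc].
rewrite sum_nat_const leq_mul2r; apply/orP; right.
apply: leq_trans (subset_leq_card (subsetDl _ _)) _.
by rewrite (nbrs_card w GE) dc.
Qed.

Definition leaves A : {set 'I_n} := [set v | (v \notin A) && (d v == 1)].

(* Double counting of the pairs (G, v), v an unexplored leaf and uw an edge of
   G: if v is far from w then the leaf edge of v can be switched with uw. *)
Lemma reveal_le E A S u w c :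
  (forall e, e \in E -> e \subset A) -> u \in A -> w \notin S ->
  (forall x, x \notin S -> d x <= c) -> [set u; w] \notin E ->
  #|extensions d ([set u; w] |: E)| * #|leaves A| <=
  d w * \sum_(v in leaves A) #|extensions d ([set u; v] |: E)|
  + #|extensions d ([set u; w] |: E)| * (c + c * c + \sum_(s in S) d s).
Proof.
move=> EA uA wS dc uwE; set q := extensions d _.
rewrite mulnC -sum_nat_const.
apply: leq_trans (_ : \sum_(v in leaves A) (#|[set G in q | v \notin near2 G w]|
   + #|[set G in q | v \in near2 G w]|) <= _).
  apply: leq_sum => v _.
  rewrite -(cardsID [set G | v \notin near2 G w] q); apply: leq_add.
    by apply: subset_leq_card; apply/subsetP => G; rewrite !inE.
  by apply: subset_leq_card; apply/subsetP => G; rewrite !in_set negbK andbC.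
rewrite big_split /=; apply: leq_add.
  rewrite big_distrr /=; apply: leq_sum => v; rewrite inE => /andP[vA /eqP dv].
  exact: (switch_leaf EA).
have cardE v : #|[set G in q | v \in near2 G w]| =
    \sum_(G in q) (v \in near2 G w).
  rewrite -big_mkcondr /= sum1dep_card; apply: eq_card => G.
  by rewrite !in_set.
under eq_bigr do rewrite cardE.
rewrite exchange_big /= -sum_nat_const; apply: leq_sum => G GE.
apply: leq_trans (card_near2 GE wS dc).
rewrite -big_mkcondr /= sum1dep_card; apply: subset_leq_card.
by apply/subsetP => v; rewrite in_set => /andP[].
Qed.
End Switching.

(** * Exploration *)

Section Clusters.
Variables (n : nat) (d : 'I_n -> nat).
Implicit Types (G E : {set {set 'I_n}}) (A S : {set 'I_n}) (u v w z : 'I_n).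

Definition reach G A : {set 'I_n} :=
  [set x | [exists a in A, connect (adj G) a x]].

Lemma reachP G A x :
  reflect (exists2 a, a \in A & connect (adj G) a x) (x \in reach G A).
Proof. by rewrite inE; exact: exists_inP. Qed.

Lemma connect_adjC G : connect_sym (adj G).
Proof. by apply: sym_connect_sym => u v; rewrite adjC. Qed.

Lemma sub_reach G A : A \subset reach G A.
Proof. by apply/subsetP => a aA; apply/reachP; exists a. Qed.

Lemma reach_reveal G A u w :
  u \in A -> adj G u w -> reach G (w |: A) = reach G A.
Proof.
move=> uA uw; apply/setP => x; apply/reachP/reachP => [[a]|[a aA ax]].
  rewrite !inE => /orP[/eqP->|aA] ax; last by exists a.
  by exists u => //; apply: connect_trans ax; exact: connect1.
by exists a => //; rewrite inE aA orbT.
Qed.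

Lemma reach_closed G A :
  (forall x y, x \in A -> adj G x y -> y \in A) -> reach G A = A.
Proof.
move=> cA; apply/eqP; rewrite eqEsubset sub_reach andbT.
have cA' : closed (adj G) A.
  by apply: (intro_closed (connect_adjC G)) => x y xy xA; exact: cA xy.
by apply/subsetP => x /reachP[a aA ax]; rewrite -(closed_connect cA' ax).
Qed.

Lemma reach_setU G A v :
  reach G (v |: A) = reach G [set v] :|: reach G A.
Proof.
apply/setP => x; rewrite in_setU; apply/reachP/orP => [[a]|].
  rewrite in_setU1 => /orP[/eqP->|aA] ax.
    by left; apply/reachP; exists v; rewrite ?inE.
  by right; apply/reachP; exists a.
by case=> /reachP[a aA ax]; exists a => //;
  rewrite in_setU1 -in_set1 aA ?orbT.
Qed.

Lemma reach_mono G A1 A2 : A1 \subset A2 -> reach G A1 \subset reach G A2.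
Proof.
move=> A12; apply/subsetP => x /reachP[a aA ax].
by apply/reachP; exists a => //; exact: (subsetP A12).
Qed.

Lemma reach1_eq G v x :
  x \in reach G [set v] -> reach G [set x] = reach G [set v].
Proof.
move=> /reachP[_ /set1P-> vx]; apply/setP => y.
apply/reachP/reachP => -[_ /set1P->] h.
  by exists v; rewrite ?inE //; exact: connect_trans h.
exists x; rewrite ?inE //; apply: connect_trans h.
by rewrite connect_adjC.
Qed.

Lemma reach1_disjoint G A v :
  v \notin reach G A -> [disjoint reach G [set v] & reach G A].
Proof.
move=> vA; apply/pred0P => x /=; apply/negP => /andP[xv /reachP[a aA ax]].
move/reachP: xv => [_ /set1P-> vx]; case/negP: vA.
apply/reachP; exists a => //; apply: connect_trans ax _.
by rewrite connect_adjC.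
Qed.

Lemma L1_reach G T : T < L1 G ->
  exists v, T < #|reach G [set v]|.
Proof.
move=> TL; apply/existsP; apply: contraLR TL => /existsPn nv.
rewrite -leqNgt; apply/bigmax_leqP => v _; move: (nv v); rewrite -leqNgt.
apply: leq_trans; apply: subset_leq_card; apply/subsetP => x.
by rewrite inE => vx; apply/reachP; exists v; rewrite ?inE.
Qed.

(** All vertices of a component share it, so one large component supplies more than [T] vertices
    satisfying [P]. Hence the division by the component size in the union bounds. *)
Lemma L1_count G T (P : pred 'I_n) : T < L1 G ->
  (forall v, T < #|reach G [set v]| -> P v) ->
  T <= \sum_v P v.
Proof.
move=> /L1_reach[v Tv] hP; apply: leq_trans (ltnW Tv) _.
rewrite -big_mkcond sum1dep_card; apply: subset_leq_card.
by apply/subsetP => x xv; rewrite inE hP // (reach1_eq xv).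
Qed.

Definition explored E A := forall e, e \in E -> e \subset A.

Lemma explored_reveal E A u w :
  explored E A -> u \in A -> explored ([set u; w] |: E) (w |: A).
Proof.
move=> EA uA e; rewrite in_setU1 => /orP[/eqP->|/EA eA].
  by apply/subsetP => x; rewrite !inE => /orP[]/eqP->; rewrite ?uA ?eqxx ?orbT.
exact: subset_trans eA (subsetUr _ _).
Qed.

Lemma saturated_reach E A G : G \in extensions d E -> explored E A ->
  (forall a, a \in A -> degree E a = d a) -> reach G A = A.
Proof.
move=> GE EA sat; have [sG dG EG] := extensionsP d E G GE.
apply: reach_closed => x y xA xy.
have : [set e in E | x \in e] == [set e in G | x \in e].
  rewrite eqEcard; apply/andP; split.
    by apply/subsetP => e; rewrite !inE => /andP[/(subsetP EG)-> ->].
  by move: (sat x xA) (dG x) => <-; rewrite /degree => ->.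
move=> /eqP/setP/(_ [set x; y]); rewrite !inE eqxx !andbT => eE.
have /EA/subsetP : [set x; y] \in E by rewrite eE.
by apply; rewrite !inE eqxx orbT.
Qed.

(** Half-edges at [S] are explored first, so a vertex outside [S] is picked only once [S] is
    saturated. When nothing can be picked, [A] is a union of components. *)
Lemma unsaturated_pick E A S G : S \subset A -> G \in extensions d E ->
  explored E A -> reach G A != A ->
  exists u, [/\ u \in A, degree E u < d u
    & u \in S \/ forall s, s \in S -> degree E s = d s].
Proof.
move=> SA GE EA nA.
have sat (B : {set 'I_n}) : ~~ [exists u in B, degree E u < d u] ->
    forall s, s \in B -> degree E s = d s.
  move=> /exists_inPn nB s /nB; rewrite -leqNgt => ds.
  by apply/eqP; rewrite eqn_leq ds (degree_ext_le s GE).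
case: (boolP [exists u in S, degree E u < d u]) => [/exists_inP[u uS du]|nS].
  by exists u; split => //; [exact: (subsetP SA)|left].
case: (boolP [exists u in A, degree E u < d u]) => [/exists_inP[u uA du]|nA'].
  by exists u; split => //; right; exact: sat.
by case/eqP: nA; apply: saturated_reach (GE) (EA) (sat _ nA').
Qed.

Definition escapes k A E := [set G in extensions d E | #|A| + k < #|reach G A|].

Lemma escapes_sub k A E : escapes k A E \subset extensions d E.
Proof. by apply/subsetP => G; rewrite in_set => /andP[]. Qed.

(** One step adds at most one vertex to [A], so the threshold [#|A| + k.+1] does not drop below the
    one used after the step. *)
Lemma escapes_step k A E u : u \in A ->
  (d u - degree E u) * #|escapes k.+1 A E| <=
  \sum_(w | [set u; w] \notin E) #|escapes k (w |: A) ([set u; w] |: E)|.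
Proof.
move=> uA; rewrite -reveal_sum; apply: leq_sum => w _.
apply: subset_leq_card; apply/subsetP => G; rewrite !in_set => /andP[GE big].
have uw : adj G u w by move: GE; rewrite subUset sub1set => /andP[_ /andP[]].
rewrite GE (reach_reveal uA uw); apply: leq_ltn_trans big.
by rewrite cardsU1 -addSnnS leq_add2r -add1n leq_add2r leq_b1.
Qed.

Lemma escapes_pick k A E S : S \subset A -> explored E A -> escapes k A E != set0 ->
  exists u, [/\ u \in A, degree E u < d u
    & u \in S \/ forall s, s \in S -> degree E s = d s].
Proof.
move=> SA EA /set0Pn[G]; rewrite in_set => /andP[GE big].
apply: (unsaturated_pick SA GE EA); apply: contraTneq big => ->.
by rewrite -leqNgt leq_addr.
Qed.
End Clusters.

From mathcomp Require Import all_classical all_reals all_analysis.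
From mathcomp Require Import ring lra.
Import numFieldNormedType.Exports.

Local Open Scope ring_scope.

(** * Drift of the exploration *)

Section Drift.
Import mathcomp.boot.fintype mathcomp.boot.finset.
Variables (K : realType) (n : nat) (d : 'I_n -> nat) (S : {set 'I_n}).
Variables (c M : nat) (q kappa : K).
Implicit Types (G E : {set {set 'I_n}}) (A : {set 'I_n}) (u v w z : 'I_n).

Hypothesis d_gt0 : forall v, (0 < d v)%N.
Hypothesis d_le : forall v, v \notin S -> (d v <= c)%N.
Hypothesis q_def : \sum_(v in ~: S) (d v)%:R * ((d v)%:R - 2) = - q.
Hypothesis q_gt0 : 0 < q.
Hypothesis q_large : M%:R + (c + c * c + \sum_(s in S) d s)%:R <= q / 2.
Hypothesis kappa_def : kappa = q / (4 * (degsum d)%:R).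

Let N E : K := #|extensions d E|%:R.
Let Q E u w : K := #|extensions d ([set u; w] |: E)|%:R.

Lemma degsum_gt0 : 0 < (degsum d)%:R :> K.
Proof.
rewrite ltr0n lt0n; apply/negP => /eqP d0.
have dv0 v : d v = 0%N.
  apply/eqP; rewrite -leqn0 -d0 /degsum (bigD1 v) //= leq_addr //.
have q0 : q = 0.
  apply: oppr_inj; rewrite -q_def oppr0 big1 // => v _.
  by rewrite dv0 mul0r.
by move: q_gt0; rewrite q0 ltxx.
Qed.

Lemma kappa_gt0 : 0 < kappa.
Proof. by rewrite kappa_def divr_gt0 // mulr_gt0 ?degsum_gt0. Qed.

Lemma drift_term_ge0 v : d v != 1%N -> 0 <= (d v)%:R * ((d v)%:R - 2) :> K.
Proof.
move=> dv; rewrite mulr_ge0 // subr_ge0 ler_nat.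
by have := d_gt0 v; case: (d v) dv => [|[|]].
Qed.

(** Solving [reveal_le] for [Q E u w] gives [rho = P1 / (n1 - beta)], with [P1] the weight of the
    [n1] unexplored leaves. These contribute [- P1 = - rho (n1 - beta)] to the drift, all other
    vertices at most [rho (#|leaves d S| - q)], and [#|leaves d S| <= n1 + M]. The sum is at most
    [rho (M + beta - q)], and [q_large] applies. *)
Lemma reveal_weight E A u : S \subset A -> explored E A -> (#|A| <= M)%N ->
  u \in A ->
  exists rho : K, [/\ 0 <= rho,
    forall w, w \notin S -> [set u; w] \notin E -> Q E u w <= rho * (d w)%:R &
    \sum_(w in ~: A) Q E u w * ((d w)%:R - 2) <= - (rho * (q / 2))].
Proof.
move=> SA EA AM uA.
set beta : K := (c + c * c + \sum_(s in S) d s)%:R.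
set P1 : K := \sum_(v in leaves d A) Q E u v.
set n1 : K := #|leaves d A|%:R.
have Mle : #|A|%:R <= M%:R :> K by rewrite ler_nat.
have SL : \sum_(v in ~: S | d v != 1%N) (d v)%:R * ((d v)%:R - 2)
    = #|leaves d S|%:R - q.
  move: q_def; rewrite (bigID [pred v | d v == 1%N]) /=.
  rewrite [X in X + _](_ : _ = - #|leaves d S|%:R); first by lra.
  rewrite (eq_bigr (fun=> -1)); last first.
    by move=> v /andP[_ /eqP->]; rewrite mul1r; ring.
  rewrite sumr_const -mulNrn; congr (_ *+ _).
  by apply: eq_card => v; rewrite unfold_in /= !inE.
have SL0 : 0 <= \sum_(v in ~: S | d v != 1%N) (d v)%:R * ((d v)%:R - 2) :> K.
  by apply: sumr_ge0 => v /andP[_]; exact: drift_term_ge0.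
have LS : #|leaves d S|%:R <= n1 + M%:R.
  apply: le_trans (_ : (#|leaves d A| + #|A|)%:R <= _).
    rewrite ler_nat; apply: leq_trans (leq_card_setU _ _).
    apply: subset_leq_card; apply/subsetP => v; rewrite !in_set.
    by move=> /andP[_ ->]; rewrite andbT; case: (v \in A).
  by rewrite natrD lerD2l.
(* Only leaves have a negative term, so there are at least [q] of them outside [S], and at most [M]
   have been explored. *)
have n1beta : 0 < n1 - beta.
  move: SL0; rewrite SL; move: q_large q_gt0; rewrite -/beta; lra.
have P10 : 0 <= P1 by apply: sumr_ge0 => v _; rewrite ler0n.
exists (P1 / (n1 - beta)); have rho0 : 0 <= P1 / (n1 - beta).
  by rewrite divr_ge0 // ltW.
have Qle w : w \notin S -> [set u; w] \notin E ->
    Q E u w <= P1 / (n1 - beta) * (d w)%:R.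
  move=> wS uwE; rewrite mulrAC ler_pdivlMr //.
  have := reveal_le EA uA wS d_le uwE.
  rewrite -(ler_nat K) natrD !natrM -/beta -/n1 natr_sum.
  by rewrite -/P1 -/(Q E u w) (mulrC P1); lra.
split=> //; set rho := P1 / _.
have P1E : P1 = rho * (n1 - beta) by rewrite divfK // gt_eqF.
have uwE w : w \notin A -> [set u; w] \notin E.
  by apply: contra => /EA/subsetP; apply; rewrite !inE eqxx orbT.
apply: le_trans (_ : - P1 + rho * (\sum_(v in ~: S | d v != 1%N)
    (d v)%:R * ((d v)%:R - 2)) <= _).
  rewrite (bigID [pred v | d v == 1%N]) /=; apply: lerD.
    rewrite /P1 -sumrN.
    rewrite [leRHS](eq_bigl [pred v | (v \in ~: A) && (d v == 1%N)]); last first.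
      by move=> v; rewrite !inE.
    by apply: ler_sum => v /andP[_ /eqP->]; rewrite mulrBr mulr1; lra.
  rewrite big_distrr /=.
  apply: le_trans (_ : \sum_(v in ~: A | d v != 1%N)
      rho * ((d v)%:R * ((d v)%:R - 2)) <= _).
    apply: ler_sum => v /andP[vA dv1]; rewrite mulrA ler_wpM2r //.
      by rewrite subr_ge0 ler_nat; have := d_gt0 v; case: (d v) dv1 => [|[|]].
    apply: Qle; last by apply: uwE; rewrite inE in vA.
    by move: vA; rewrite inE; apply: contra => /(subsetP SA).
  rewrite big_mkcond [leRHS]big_mkcond /=; apply: ler_sum => v _.
  case: (boolP (d v == 1%N)) => dv; first by rewrite !andbF.
  have t0 : 0 <= rho * ((d v)%:R * ((d v)%:R - 2)).
    by rewrite mulr_ge0 // drift_term_ge0.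
  rewrite !andbT !inE; case: (boolP (v \in A)) => vA /=; first by case: ifP.
  by rewrite (contra (subsetP SA v) vA).
rewrite SL P1E -mulrN -mulrDr -mulrN ler_wpM2l //.
by move: q_large; rewrite -/beta; lra.
Qed.

(* A half-edge at S weighs 1 + kappa, so that revealing an edge at S lowers the
   potential by kappa although it may give no drift of that size. *)
Definition openings A E : K := \sum_(w in A) ((d w)%:R - (degree E w)%:R).
Definition potential A E : K := openings A E + kappa * openings S E.

Lemma openings_ge0 A E G : G \in extensions d E -> 0 <= openings A E.
Proof.
move=> GE; apply: sumr_ge0 => w _.
by rewrite subr_ge0 ler_nat (degree_ext_le w GE).
Qed.

Lemma potential_ge0 A E G : G \in extensions d E -> 0 <= potential A E.
Proof.
move=> GE; have k0 := ltW kappa_gt0.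
by rewrite addr_ge0 ?mulr_ge0 // (openings_ge0 _ GE).
Qed.

Lemma openings_reveal A E u w : u != w -> [set u; w] \notin E ->
  openings A ([set u; w] |: E) =
  openings A E - (u \in A)%:R - (w \in A)%:R.
Proof.
move=> uw uwE; rewrite /openings.
have ind x : \sum_(y in A) (y == x)%:R = (x \in A)%:R :> K.
  case: (boolP (x \in A)) => xA.
    by rewrite (bigD1 x) //= eqxx big1 ?addr0 // => y /andP[_ /negPf->].
  by rewrite big1 // => y yA; case: eqP xA => // <-; rewrite yA.
rewrite -!ind -!sumrB; apply: eq_bigr => y _.
by rewrite degreeU1 // natrD mem_set2 // natrD; ring.
Qed.

Lemma degree_unexplored E A w : explored E A -> w \notin A -> degree E w = 0%N.
Proof.
move=> EA wA; apply/eqP; rewrite cards_eq0; apply/eqP/setP => e; rewrite !inE.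
by apply: contraNF wA => /andP[/EA/subsetP]; apply.
Qed.

(** Both ends of [uw] are used up, and a new [w] brings [d w] half-edges. The further loss of
    [kappa] when [w] lies in [S] is discarded. *)
Lemma potential_reveal E A u w G : S \subset A -> explored E A -> u \in A ->
  G \in extensions d ([set u; w] |: E) -> [set u; w] \notin E ->
  potential (w |: A) ([set u; w] |: E) <=
  potential A E - kappa * (u \in S)%:R
    + (if w \in A then - 2 else (d w)%:R - 2).
Proof.
move=> SA EA uA GE uwE.
have uw : u != w.
  have [sG _ /subsetP/(_ [set u; w])] := extensionsP d _ G GE.
  by rewrite !inE eqxx => /(_ isT); exact: adj_neq.
rewrite /potential !openings_reveal // !inE eqxx uA orbT /=.
have := kappa_gt0; set k := kappa => k0.
have -> : openings (w |: A) E = openings A E + (if w \in A then 0 else (d w)%:R).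
  case: (boolP (w \in A)) => wA.
    by rewrite addr0; congr openings; apply/setUidPr; rewrite sub1set.
  by rewrite /openings big_setU1 //= (degree_unexplored EA wA) subr0 addrC.
have : 0 <= k * (w \in S)%:R by rewrite mulr_ge0 // ltW.
by case: (w \in A); lra.
Qed.

Lemma reveal_total E u (dE : (degree E u <= d u)%N) :
  \sum_(w | [set u; w] \notin E) Q E u w = ((d u)%:R - (degree E u)%:R) * N E.
Proof. by rewrite -natrB // -natrM -reveal_sum1 natr_sum. Qed.

(* Since S is saturated, no edge at u leads to S, and the total weight of the
   remaining choices bounds rho from below. *)
Lemma saturated_total E A u rho : S \subset A -> explored E A ->
  (degree E u <= d u)%N -> (forall s, s \in S -> degree E s = d s) ->
  (forall w, w \notin S -> [set u; w] \notin E -> Q E u w <= rho * (d w)%:R) ->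
  0 <= rho ->
  ((d u)%:R - (degree E u)%:R) * N E <= rho * (degsum d)%:R.
Proof.
move=> SA EA dE sat Qle rho0; rewrite -reveal_total // /degsum natr_sum big_distrr.
rewrite big_mkcond /=; apply: ler_sum => w _; case: ifP => uwE; last first.
  by rewrite mulr_ge0.
case: (boolP (w \in S)) => wS; last exact: Qle.
rewrite /Q (_ : extensions _ _ = set0) ?cards0 ?mulr_ge0 //.
apply/setP => G; rewrite [RHS]inE; apply/negP => GE.
have := degree_ext_le w GE.
by rewrite degreeU1 // !inE eqxx orbT sat // ltnn.
Qed.

(** A loss of [kappa] per edge costs only half of the drift [rho * (q / 2)]. The exponential
    argument spends the other half on its second-order term. *)
Lemma saturated_kappa (x rho : K) : 0 <= x -> x <= rho * (degsum d)%:R ->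
  x * kappa <= rho * (q / 4).
Proof.
move=> x0 xle; rewrite kappa_def; set m := (degsum d)%:R in xle *.
have m0 : 0 < m := degsum_gt0.
rewrite (_ : rho * _ = rho * m * (q / (4 * m))).
  by rewrite ler_wpM2r // divr_ge0 ?mulr_ge0 ?ltW.
by field; rewrite gt_eqF.
Qed.

(** For [u] in [S] the extra weight of its half-edge pays [kappa], and a nonpositive drift suffices.
    Otherwise [S] is saturated, and the total weight of the choices turns the drift into [kappa] per
    edge. *)
Lemma linear_step E A u : S \subset A -> explored E A -> (#|A| <= M)%N ->
  u \in A -> (degree E u <= d u)%N ->
  (u \in S \/ forall s, s \in S -> degree E s = d s) ->
  \sum_(w | [set u; w] \notin E) Q E u w * potential (w |: A) ([set u; w] |: E)
  <= ((d u)%:R - (degree E u)%:R) * N E * (potential A E - kappa).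
Proof.
move=> SA EA AM uA dE uS.
have [rho [rho0 Qle drift]] := reveal_weight SA EA AM uA.
set Y := potential A E.
apply: (@le_trans _ _ (\sum_(w | [set u; w] \notin E)
   Q E u w * (Y - kappa * (u \in S)%:R) +
   \sum_(w in ~: A) Q E u w * ((d w)%:R - 2))).
  rewrite big_mkcond [X in _ <= X + _]big_mkcond [X in _ <= _ + X]big_mkcond /=.
  rewrite -big_split /=; apply: ler_sum => w _; rewrite in_setC.
  case: ifPn => uwE; last first.
    rewrite (_ : w \in A) ?addr0 //.
    by move/negPn: uwE => /EA/subsetP; apply; rewrite !inE eqxx orbT.
  (* Without extensions the weight is zero. This disposes of [w = u], as a simple graph has no
     loop. *)
  have [G0|[G GE]] := set_0Vmem (extensions d ([set u; w] |: E)).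
    by rewrite /Q G0 cards0 !mul0r; case: ifP; rewrite ?addr0.
  have := potential_reveal SA EA uA GE uwE; rewrite -/Y => Yw.
  apply: le_trans (ler_wpM2l _ Yw) _; first by rewrite ler0n.
  rewrite mulrDr lerD2l; case: (w \in A) => //=.
  by rewrite mulr_ge0_le0 // ?ler0n //; lra.
rewrite -big_distrl /= reveal_total //; set dN := _ * N E.
have dN0 : 0 <= dN by rewrite mulr_ge0 ?ler0n // subr_ge0 ler_nat.
have rq0 : 0 <= rho * (q / 2) by rewrite mulr_ge0 // divr_ge0 // ltW.
case: (boolP (u \in S)) => [uS1|uS1]; first by rewrite mulr1; lra.
have {uS}sat : forall s, s \in S -> degree E s = d s.
  by case: uS => // uS; rewrite uS in uS1.
have dNle := saturated_total SA EA dE sat Qle rho0; rewrite -/dN in dNle.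
have := saturated_kappa dN0 dNle.
by rewrite mulr0 subr0; lra.
Qed.

(** From [exp (- x) >= 1 - x] follows [exp x <= 1 / (1 - x)], and
    [(1 - x)(1 + x + 2x^2) = 1 + x^2 (1 - 2x)]. No lower bound on [x] is imposed, so jumps down may
    be large. *)
Lemma expR_le_quadratic (x : K) : x <= 1 / 2 -> expR x <= 1 + x + 2 * x ^+ 2.
Proof.
move=> x2; have x1 : 0 < 1 - x by lra.
have := expR_ge1Dx (- x); rewrite expRN => h.
have e0 := expR_gt0 x.
apply: (@le_trans _ _ (1 - x)^-1).
  by rewrite -(invrK (expR x)) lef_pV2 ?posrE ?invr_gt0.
rewrite -div1r ler_pdivrMr //.
have : 0 <= x ^+ 2 * (1 - 2 * x) by rewrite mulr_ge0 ?sqr_ge0 //; lra.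
rewrite !exprS expr0 mulr1; nra.
Qed.

(** * The exponential supermartingale *)

Section Exponential.
Variables (theta : K).
Hypothesis theta_ge0 : 0 <= theta.
Hypothesis theta_jump : theta * (c%:R - 2) <= 1 / 2.
Hypothesis theta_var :
  theta * \sum_(v in ~: S) (d v)%:R * ((d v)%:R - 2) ^+ 2 <= q / 8.

(** In the quadratic expansion, [theta_var] bounds the second-order part by [theta * rho * (q / 4)],
    half of the first-order drift. The condition [theta_jump] makes the expansion valid for every
    new vertex, all of which have degree at most [c]. *)
Lemma exponential_step E A u : S \subset A -> explored E A -> (#|A| <= M)%N ->
  u \in A -> (degree E u <= d u)%N ->
  (u \in S \/ forall s, s \in S -> degree E s = d s) ->
  \sum_(w | [set u; w] \notin E)
    Q E u w * expR (theta * potential (w |: A) ([set u; w] |: E))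
  <= ((d u)%:R - (degree E u)%:R) * N E * expR (theta * (potential A E - kappa)).
Proof.
move=> SA EA AM uA dE uS.
have [rho [rho0 Qle drift]] := reveal_weight SA EA AM uA.
set Y := potential A E.
pose e0 := expR (theta * (Y - kappa * (u \in S)%:R)).
apply: (@le_trans _ _ (e0 * (\sum_(w | [set u; w] \notin E) Q E u w +
   \sum_(w in ~: A) Q E u w *
     (theta * ((d w)%:R - 2) + 2 * (theta * ((d w)%:R - 2)) ^+ 2)))).
  rewrite big_mkcond [X in _ <= _ * (X + _)]big_mkcond.
  rewrite [X in _ <= _ * (_ + X)]big_mkcond /= -big_split big_distrr /=.
  apply: ler_sum => w _; rewrite in_setC.
  case: ifPn => uwE; last first.
    rewrite (_ : w \in A) ?addr0 ?mulr0 //.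
    by move/negPn: uwE => /EA/subsetP; apply; rewrite !inE eqxx orbT.
  have [G0|[G GE]] := set_0Vmem (extensions d ([set u; w] |: E)).
    by rewrite /Q G0 cards0 !mul0r; case: ifP; rewrite ?addr0 ?mulr0.
  have := potential_reveal SA EA uA GE uwE; rewrite -/Y => Yw.
  have Q0 : 0 <= Q E u w by rewrite ler0n.
  apply: (@le_trans _ _ (Q E u w * (e0 *
     expR (theta * (if w \in A then - 2 else (d w)%:R - 2))))).
    rewrite -expRD -mulrDr; apply: ler_wpM2l => //.
    by rewrite ler_expR ler_wpM2l.
  rewrite mulrCA; apply: ler_wpM2l; first exact: expR_ge0.
  case: (boolP (w \in A)) => wA /=.
    rewrite addr0 ler_piMr // -expR0 ler_expR mulr_ge0_le0 //; lra.
  rewrite -[X in _ <= X + _]mulr1 -mulrDr ler_wpM2l // addrA.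
  apply: expR_le_quadratic; apply: le_trans theta_jump.
  rewrite ler_wpM2l // lerD2r ler_nat d_le //.
  by apply: contra wA => /(subsetP SA).
rewrite reveal_total //; set dN := _ * N E.
have dN0 : 0 <= dN by rewrite mulr_ge0 ?ler0n // subr_ge0 ler_nat.
have t8 : \sum_(w in ~: A) Q E u w *
     (theta * ((d w)%:R - 2) + 2 * (theta * ((d w)%:R - 2)) ^+ 2)
   <= - (theta * rho * (q / 4)).
  apply: (@le_trans _ _ (theta * \sum_(w in ~: A) Q E u w * ((d w)%:R - 2) +
    2 * theta ^+ 2 * (rho * \sum_(v in ~: S) (d v)%:R * ((d v)%:R - 2) ^+ 2))).
    rewrite [X in _ <= X + _]big_distrr /=.
    apply: (@le_trans _ _ (\sum_(w in ~: A) theta * (Q E u w * ((d w)%:R - 2))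
       + 2 * theta ^+ 2 * (\sum_(w in ~: A) rho * ((d w)%:R * ((d w)%:R - 2) ^+ 2)))).
      rewrite [X in _ <= _ + X]big_distrr -big_split /=; apply: ler_sum => w.
      rewrite in_setC => wA; rewrite mulrDr; apply: lerD; first by rewrite mulrCA.
      rewrite exprMn; set D2 := (_ - 2) ^+ 2.
      have D20 : 0 <= D2 by exact: sqr_ge0.
      rewrite (_ : Q E u w * _ = 2 * theta ^+ 2 * (Q E u w * D2)); last by ring.
      rewrite ler_wpM2l ?mulr_ge0 ?sqr_ge0 // (mulrA rho) ler_wpM2r // Qle //.
        by apply: contra wA => /(subsetP SA).
      by apply: contra wA => /EA/subsetP; apply; rewrite !inE eqxx orbT.
    rewrite lerD2l ler_wpM2l ?mulr_ge0 ?sqr_ge0 //.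
    rewrite [leRHS]big_distrr /= big_mkcond [leRHS]big_mkcond /=.
    apply: ler_sum => w _; rewrite !in_setC.
    have t0 : 0 <= rho * ((d w)%:R * ((d w)%:R - 2) ^+ 2).
      by rewrite mulr_ge0 // mulr_ge0 // sqr_ge0.
    case: (boolP (w \in A)) => wA /=; first by case: ifP.
    by rewrite (contra (subsetP SA w) wA).
  have := ler_wpM2l theta_ge0 drift.
  have := ler_wpM2l (mulr_ge0 theta_ge0 rho0) theta_var.
  set V := \sum_(v in ~: S) _; rewrite expr2; lra.
have tq0 : 0 <= theta * rho * (q / 4) by rewrite !mulr_ge0 ?invr_ge0 // ltW.
case: (boolP (u \in S)) => [uS1|uS1].
  rewrite /e0 uS1 mulr1 (mulrC dN) ler_wpM2l ?expR_ge0 //; lra.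
have {uS}sat : forall s, s \in S -> degree E s = d s.
  by case: uS => // uS; rewrite uS in uS1.
have dNle := saturated_total SA EA dE sat Qle rho0; rewrite -/dN in dNle.
have dk := saturated_kappa dN0 dNle.
rewrite /e0 (negPf uS1) mulr0 subr0 mulrBr expRD mulrCA.
rewrite ler_wpM2l ?expR_ge0 //.
apply: (@le_trans _ _ (dN * (1 - theta * kappa))); last first.
  by rewrite ler_wpM2l // expR_ge1Dx.
have := ler_wpM2l theta_ge0 dk; lra.
Qed.

(** Each survived step gains a factor [exp (- theta * kappa)]. At [k = 0] the right side is at least
    [N E] because the potential is nonnegative. The bound by [M] keeps the drift estimate available
    throughout. *)
Lemma exponential_bound k A E : S \subset A -> explored E A ->
  (#|A| + k <= M)%N ->
  #|escapes d k A E|%:R <= N E * expR (theta * (potential A E - kappa * k%:R)).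
Proof.
elim: k A E => [|k IHk] A E SA EA AM.
  have [E0|[G GE]] := set_0Vmem (extensions d E).
    rewrite (_ : escapes d 0 A E = finset.set0) ?cards0 ?mulr_ge0 ?expR_ge0 //.
    by apply/eqP; rewrite -subset0 -E0 escapes_sub.
  apply: (@le_trans _ _ (N E)).
    by rewrite ler_nat subset_leq_card ?escapes_sub.
  by rewrite ler_peMr // -expR0 ler_expR mulr0 subr0 mulr_ge0 // (potential_ge0 _ GE).
have [->|esc] := eqVneq (escapes d k.+1 A E) finset.set0.
  by rewrite cards0 mulr_ge0 // expR_ge0.
have [u [uA du uS]] := escapes_pick SA EA esc.
have d0 : 0 < ((d u)%:R - (degree E u)%:R) :> K by rewrite subr_gt0 ltr_nat.
rewrite -(ler_pM2l d0) -natrB ?(ltnW du) // -natrM.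
apply: le_trans (_ : (\sum_(w | [set u; w] \notin E)
  #|escapes d k (w |: A) ([set u; w] |: E)|)%:R <= _).
  by rewrite ler_nat; exact: escapes_step.
rewrite natr_sum.
apply: (@le_trans _ _ (\sum_(w | [set u; w] \notin E)
    Q E u w * expR (theta * potential (w |: A) ([set u; w] |: E)) *
    expR (- (theta * (kappa * k%:R))))).
  apply: ler_sum => w uwE; rewrite -mulrA -expRD -mulrBr; apply: IHk.
  - exact: subset_trans SA (subsetUr _ _).
  - exact: explored_reveal.
  - apply: leq_trans AM.
    by rewrite cardsU1 -addSnnS leq_add2r -add1n leq_add2r leq_b1.
rewrite -big_distrl /=.
have AM' : (#|A| <= M)%N by apply: leq_trans AM; rewrite leq_addr.
have := exponential_step SA EA AM' uA (ltnW du) uS.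
move=> /(ler_wpM2r (expR_ge0 (- (theta * (kappa * k%:R))))) /le_trans; apply.
rewrite natrB ?(ltnW du) // -!mulrA -expRD.
rewrite (_ : theta * _ + _ = theta * (potential A E - kappa * k.+1%:R)) //.
by rewrite -natr1; ring.
Qed.
End Exponential.

(** The mean potential falls by [kappa] per step and stays nonnegative, so the expected number of
    steps is at most the initial potential over [kappa]. *)
Lemma linear_bound k A E : S \subset A -> explored E A -> (#|A| + k <= M)%N ->
  kappa * k%:R * #|escapes d k A E|%:R <= N E * potential A E.
Proof.
elim: k A E => [|k IHk] A E SA EA AM.
  have [E0|[G GE]] := set_0Vmem (extensions d E).
    by rewrite /N E0 cards0 mulr0 !mul0r.
  by rewrite mulr0 mul0r mulr_ge0 // (potential_ge0 _ GE).
have k0 := kappa_gt0.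
have [esc0|esc] := eqVneq (escapes d k.+1 A E) finset.set0.
  have [E0|[G GE]] := set_0Vmem (extensions d E).
    by rewrite /N E0 esc0 cards0 mulr0 !mul0r.
  by rewrite esc0 cards0 mulr0 mulr_ge0 // (potential_ge0 _ GE).
have [u [uA du uS]] := escapes_pick SA EA esc.
have d0 : 0 < ((d u)%:R - (degree E u)%:R) :> K by rewrite subr_gt0 ltr_nat.
rewrite -(ler_pM2l d0).
have AM' : (#|A| <= M)%N by apply: leq_trans AM; rewrite leq_addr.
have step := linear_step SA EA AM' uA (ltnW du) uS.
have le1 : kappa * #|escapes d k.+1 A E|%:R <= kappa * N E.
  by rewrite ler_wpM2l ?(ltW k0) // /N ler_nat subset_leq_card ?escapes_sub.
have le2 : kappa * k%:R * (((d u)%:R - (degree E u)%:R) * #|escapes d k.+1 A E|%:R)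
    <= \sum_(w | [set u; w] \notin E)
         Q E u w * potential (w |: A) ([set u; w] |: E).
  apply: (@le_trans _ _ (kappa * k%:R * (\sum_(w | [set u; w] \notin E)
     #|escapes d k (w |: A) ([set u; w] |: E)|)%:R)).
    rewrite ler_wpM2l ?mulr_ge0 ?(ltW k0) // -natrB ?(ltnW du) // -natrM ler_nat.
    exact: escapes_step.
  rewrite natr_sum big_distrr /=; apply: ler_sum => w uwE; apply: IHk.
  - exact: subset_trans SA (subsetUr _ _).
  - exact: explored_reveal.
  - apply: leq_trans AM.
    by rewrite cardsU1 -addSnnS leq_add2r -add1n leq_add2r leq_b1.
have := ler_wpM2l (ltW d0) le1; rewrite -natr1.
by move: le2 step; lra.
Qed.

(** The cap [T] on the component of [A] ensures that [k] more steps, taken from [v], still stay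
    within the [M] vertices for which the drift holds. *)
Definition fresh_escapes T k v A E :=
  [set G in extensions d E | [&& v \notin reach G A, (#|reach G A| <= T)%N
     & (1 + k < #|reach G [set v]|)%N]].

Lemma fresh_escapes_step T k v A E u : u \in A ->
  ((d u - degree E u) * #|fresh_escapes T k v A E| <=
  \sum_(w | [set u; w] \notin E) #|fresh_escapes T k v (w |: A) ([set u; w] |: E)|)%N.
Proof.
move=> uA; rewrite -reveal_sum; apply: leq_sum => w _.
apply: subset_leq_card; apply/subsetP => G; rewrite in_set => /andP[GE big].
have uw : adj G u w by move: GE; rewrite extensionsU1 => /andP[].
by rewrite in_set GE (reach_reveal uA uw).
Qed.

(* The component of A is explored to its end before v is added to it, at which
   moment all its half-edges are used and the potential is the degree of v. *)
Lemma fresh_bound T k v A E : S \subset A -> explored E A ->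
  (T + 1 + k <= M)%N ->
  kappa * k%:R * #|fresh_escapes T k v A E|%:R <= N E * (d v)%:R.
Proof.
move=> + + TM; have k0 := kappa_gt0.
(* The component of [A] is exhausted in an unspecified number of steps, so the induction is on the
   number of pairs and other sets not yet in [E]. *)
have [r] := ubnP #|~: E|; elim: r A E => // r IHr A E Er SA EA.
have [->|[G0 G0F]] := set_0Vmem (fresh_escapes T k v A E).
  by rewrite cards0 mulr0 mulr_ge0.
have : G0 \in extensions d E by move: G0F; rewrite in_set => /andP[].
case: (boolP [exists u in A, degree E u < d u]%N) => [/exists_inP[u uA du] _|nA GE].
  have d0 : 0 < ((d u)%:R - (degree E u)%:R) :> K by rewrite subr_gt0 ltr_nat.
  rewrite -(ler_pM2l d0) mulrCA [leRHS]mulrA.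
  apply: (@le_trans _ _ (kappa * k%:R * (\sum_(w | [set u; w] \notin E)
     #|fresh_escapes T k v (w |: A) ([set u; w] |: E)|)%:R)).
    rewrite ler_wpM2l ?mulr_ge0 ?(ltW k0) // -natrB ?(ltnW du) // -natrM ler_nat.
    exact: fresh_escapes_step.
  rewrite natr_sum big_distrr /= -reveal_total ?(ltnW du) // big_distrl /=.
  apply: ler_sum => w uwE; apply: IHr.
  - rewrite setCU setIC -setDE; apply: (@leq_trans #|~: E|) => //.
    by apply/proper_card/properD1; rewrite inE.
  - exact: subset_trans SA (subsetUr _ _).
  - exact: explored_reveal.
have sat a : a \in A -> degree E a = d a.
  move=> aA; apply/eqP; rewrite eqn_leq (degree_ext_le a GE) /= leqNgt.
  by apply: contra nA => da; apply/exists_inP; exists a.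
have clA G : G \in extensions d E -> reach G A = A.
  by move=> GE'; exact: saturated_reach GE' EA sat.
move: G0F; rewrite in_set => /and4P[_]; rewrite clA // => vA AT _.
have EvA : explored E (v |: A).
  by move=> e eE; apply: subset_trans (EA e eE) (subsetUr _ _).
have pot : potential (v |: A) E = (d v)%:R.
  rewrite /potential /openings big_setU1 //= (degree_unexplored EA vA) subr0.
  rewrite !big1 ?addr0 ?mulr0 ?addr0 //= => a aA; rewrite sat ?subrr //.
  exact: (subsetP SA).
rewrite -pot; have SvA : S \subset v |: A := subset_trans SA (subsetUr _ _).
have vAM : (#|v |: A| + k <= M)%N.
  rewrite cardsU1 vA (addnC true); apply: leq_trans TM.
  by rewrite leq_add2r leq_add2r.
apply: le_trans (linear_bound SvA EvA vAM).
rewrite ler_wpM2l ?mulr_ge0 ?(ltW k0) // ler_nat; apply: subset_leq_card.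
apply/subsetP => G; rewrite in_set => /and4P[GE' vcl _ big]; rewrite in_set GE' /=.
rewrite reach_setU cardsU1 vA [X in (_ < X)%N]cardsU.
rewrite (disjoint_setI0 (reach1_disjoint vcl)) cards0 subn0 (clA G GE').
by rewrite addnAC ltn_add2r.
Qed.
End Drift.

(** * The set of heavy vertices *)

Section HeavySet.
Import mathcomp.boot.fintype mathcomp.boot.finset.
Variables (K : realType) (n : nat) (d : 'I_n -> nat).
Implicit Types (A B S : {set 'I_n}) (v : 'I_n).

Definition drift A : K := \sum_(v in A) (d v)%:R * ((d v)%:R - 2).
Definition weight A : K := (\sum_(v in A) d v)%:R.

Lemma excessE A : (excess d A)%:~R = drift A.
Proof.
rewrite /excess rmorph_sum; apply: eq_bigr => v _.
by rewrite rmorphM rmorphB /= -!pmulrn.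
Qed.

Lemma mstar_drift : drift (~: Sstar d) <= 0.
Proof.
rewrite -excessE -[leRHS](mulr0z 1) ler_int /Sstar; case: arg_minnP => [|S /andP[]//].
apply/andP; split; last by rewrite setCT /excess big_set0.
by apply/forall_inP => u _; apply/forall_inP => v; rewrite setCT inE.
Qed.

(** A largest admissible set works: if its weight were below [20 * x], the highest vertex outside,
    of degree at most [x], could be added unless all remaining degrees are at most 2. *)
Lemma heavy_set_exists (x : K) : (maxdeg d)%:R <= x ->
  exists S, [/\ weight S <= 21 * x, forall v, v \in S -> (3 <= d v)%N,
    forall u v, u \in S -> v \notin S -> (d v <= d u)%N &
    (forall v, v \notin S -> (d v <= 2)%N) \/ 20 * x <= weight S].
Proof.
move=> dx; have x0 : 0 <= x by apply: le_trans dx.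
pose P S := [&& `[< weight S <= 21 * x >], highest_degrees d S
  & [forall v in S, 3 <= d v]%N].
have P0 : P finset.set0.
  apply/and3P; split.
  - by apply/asboolP; rewrite /weight big_set0 mulr_ge0.
  - by apply/forall_inP => u; rewrite inE.
  - by apply/forall_inP => u; rewrite inE.
have [S /and3P[/asboolP wS /forall_inP hS /forall_inP dS] Smax] :=
  arg_maxnP (fun S : {set 'I_n} => #|S|) P0.
have high u v : u \in S -> v \notin S -> (d v <= d u)%N.
  by move=> uS vS; apply: (forall_inP (hS u uS)); rewrite inE.
exists S; split=> //.
case: (boolP [exists v in ~: S, 3 <= d v]%N) => [/exists_inP[v0]|]; last first.
  move=> /exists_inPn h; left => v vS; rewrite leqNgt; apply: h.
  by rewrite inE.
rewrite in_setC => v0S dv0; right.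
have [v vS vmax] := @arg_maxnP _ v0 (fun v => v \notin S) d v0S.
rewrite leNgt; apply/negP => wS20.
have /Smax : P (v |: S).
  apply/and3P; split.
  - apply/asboolP; rewrite /weight big_setU1 //= natrD.
    have : (d v)%:R <= x by apply: le_trans dx; rewrite ler_nat leq_bigmax.
    by move: wS20; rewrite /weight; lra.
  - apply/forall_inP => u; rewrite in_setU1 => uS.
    apply/forall_inP => y; rewrite in_setC in_setU1 negb_or => /andP[_ yS].
    by case/orP: uS => [/eqP->|uS]; [exact: vmax|exact: high].
  - apply/forall_inP => u; rewrite in_setU1 => /orP[/eqP->|/dS//].
    by apply: leq_trans dv0 (vmax _ _).
by rewrite cardsU1 vS add1n /= ltnn.
Qed.

(* Among all sets B, the sum of d(d - c) over B is maximal at S. *)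
Lemma drift_exchange S B (c : nat) :
  (forall v, v \in S -> (c <= d v)%N) -> (forall v, v \notin S -> (d v <= c)%N) ->
  drift (~: S) + (c%:R - 2) * (weight S - weight B) <= drift (~: B).
Proof.
move=> Sc cS.
have total A : drift (~: A) = \sum_v (d v)%:R * ((d v)%:R - 2) - drift A.
  rewrite /drift [X in _ = X - _](bigID (mem A)) /= [X in _ = X]addrAC subrr.
  by rewrite add0r; apply: eq_bigl => v; rewrite inE.
have dc A : \sum_(v in A) (d v)%:R * ((d v)%:R - c%:R) =
    drift A - (c%:R - 2) * weight A.
  rewrite /drift /weight natr_sum big_distrr -sumrB /=.
  by apply: eq_bigr => v _; ring.
have : \sum_(v in B) (d v)%:R * ((d v)%:R - c%:R)
   <= \sum_(v in S) (d v)%:R * ((d v)%:R - c%:R) :> K.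
  rewrite big_mkcond [leRHS]big_mkcond /=; apply: ler_sum => v _.
  case: (boolP (v \in S)) => [/Sc|/cS]; rewrite -(ler_nat K) => cv.
    by case: ifP => _ //; rewrite mulr_ge0 // subr_ge0.
  by case: ifP => _ //; rewrite mulr_ge0_le0 // subr_le0.
by rewrite !dc !total; lra.
Qed.

(** Here [c] is the maximum degree outside [S], raised to 2 if necessary. Exchanging [S] with [B]
    gives the drift; exchanging it with [Sstar d] gives the last bound, where [59 / 3 = 20 - 1 / 3]
    because the weight of [Sstar d] is at most [x / 3]. *)
Lemma heavy_set (x a : K) : 0 <= x ->
  (maxdeg d)%:R <= x -> 3 * (mstar d)%:R <= x ->
  (exists B, weight B <= x /\ drift (~: B) <= - a) ->
  exists S (c : nat), [/\ weight S <= 21 * x,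
    forall v, v \notin S -> (d v <= c)%N,
    (2 <= c <= maxn 2 (maxdeg d))%N,
    drift (~: S) <= - a &
    c = 2%N \/ 59 / 3 * (c%:R - 2) * x <= - drift (~: S)].
Proof.
move=> x0 dx mx [B [wB dB]].
have [S [wS S3 hS S20]] := heavy_set_exists dx.
pose c := maxn 2 (\max_(v in ~: S) d v).
have cS v : v \notin S -> (d v <= c)%N.
  move=> vS; rewrite leq_max; apply/orP; right.
  by apply: (@leq_bigmax_cond _ _ d); rewrite inE.
have Sc v : v \in S -> (c <= d v)%N.
  move=> vS; rewrite geq_max (ltnW (S3 v vS)); apply/bigmax_leqP => u.
  by rewrite inE; exact: hS.
have c2 : (2 <= c)%N by rewrite leq_maxl.
have cx : (c <= maxn 2 (maxdeg d))%N.
  rewrite geq_max leq_maxl /= leq_max; apply/orP; right.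
  by apply/bigmax_leqP => u _; exact: leq_bigmax.
have c20 : 0 <= c%:R - 2 :> K by rewrite subr_ge0 ler_nat.
have big : c = 2%N \/ 20 * x <= weight S.
  case: S20 => [le2|]; [left|by right].
  apply/eqP; rewrite eqn_leq c2 andbT geq_max leqnn /=.
  by apply/bigmax_leqP => u; rewrite inE; exact: le2.
exists S, c; split=> //; first by rewrite c2.
  apply: le_trans dB; apply: le_trans (drift_exchange B Sc cS).
  rewrite lerDl; case: big => [->|big]; first by rewrite subrr mul0r.
  by rewrite mulr_ge0 // subr_ge0; lra.
case: big => [->|big]; [by left|right].
have ex := drift_exchange (Sstar d) Sc cS; have st := mstar_drift.
have : (c%:R - 2) * (59 / 3 * x) <= (c%:R - 2) * (weight S - weight (Sstar d)).
  by rewrite ler_wpM2l // /weight -/(mstar d); rewrite -/(weight S); lra.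
lra.
Qed.
End HeavySet.

(** * Failure probability for a fixed number of vertices *)

Section FixedSize.
Import mathcomp.boot.fintype mathcomp.boot.finset.
Variables (K : realType) (n : nat) (d : 'I_n -> nat).
Implicit Types (A B S : {set 'I_n}) (v : 'I_n) (G : {set {set 'I_n}}).

Let m : K := (degsum d)%:R.
Let N : K := #|realizations d|%:R.

Lemma extensions0 : extensions d finset.set0 = realizations d.
Proof. by apply/setP => G; rewrite in_set sub0set andbT. Qed.

Lemma explored0 A : explored (finset.set0 : {set {set 'I_n}}) A.
Proof. by move=> e; rewrite inE. Qed.

Lemma L1_double_count T (R : {set {set {set 'I_n}}}) :
  (T * #|[set G in R | T < L1 G]| <=
   \sum_v #|[set G in R | T < #|reach G [set v]|]|)%N.
Proof.
have cardE v : #|[set G in R | (T < #|reach G [set v]|)%N]| =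
    (\sum_(G in R) (T < #|reach G [set v]|)%N)%N.
  rewrite -big_mkcondr /= sum1dep_card; apply: eq_card => G.
  by rewrite !in_set.
under eq_bigr do rewrite cardE.
rewrite exchange_big /= mulnC -sum_nat_const.
rewrite big_mkcond [leqRHS]big_mkcond /=; apply: leq_sum => G _.
rewrite in_set; case: (G \in R) => //=; case: ifP => // TL.
exact: (@L1_count _ G T (fun v => T < #|reach G [set v]|)%N).
Qed.

Lemma unifprob_ge (e : K) (P : pred {set {set 'I_n}}) : 0 < N ->
  #|[set G in realizations d | ~~ P G]|%:R <= e * N -> 1 - e <= unifprob K d P.
Proof.
move=> N0 Pe; rewrite /unifprob -/N ler_pdivlMr // mulrBl mul1r lerBlDr.
apply: le_trans (lerD (lexx _) Pe).
rewrite -natrD ler_nat -(cardsID [set G | P G] (realizations d)).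
by apply: leq_add; apply: subset_leq_card; apply/subsetP => G; rewrite !in_set
  // andbC.
Qed.

Lemma unifprob_le1 (P : pred {set {set 'I_n}}) : 0 < N -> unifprob K d P <= 1.
Proof.
move=> N0; rewrite /unifprob ler_pdivrMr // mul1r ler_nat.
by apply: subset_leq_card; apply/subsetP => G; rewrite in_set => /andP[].
Qed.

(* Here x, a and w stand for m_0, |Q_0| and omega. The component of the heavy
   set S, or of S + v, is explored for k steps with k close to 240 x / a. As
   kappa >= a / 4, the potential then loses 60 x, against an initial value of at
   most 44 x. *)
Variables (x a w : K) (S : {set 'I_n}) (c k : nat).
Let q : K := - drift K d (~: S).
Let V : K := \sum_(v in ~: S) (d v)%:R * ((d v)%:R - 2) ^+ 2.
(* The second k is for the component explored after that of S. *)
Let M : nat := (#|S| + 1 + k + k)%N.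
Let T : nat := (#|S| + 1 + k)%N.
Let kappa : K := q / (4 * m).

Hypothesis n_gt0 : (0 < n)%N.
Hypothesis d_gt0 : forall v, (0 < d v)%N.
Hypothesis N_gt0 : 0 < N.
Hypothesis a_gt0 : 0 < a.
Hypothesis a_le1 : a <= 1.
Hypothesis dx : (maxdeg d)%:R <= x.
Hypothesis wx : w * x <= a ^+ 2 * n%:R.
Hypothesis w_large : 8000 <= w.
Hypothesis weightS : weight K d S <= 21 * x.
Hypothesis d_le : forall v, v \notin S -> (d v <= c)%N.
Hypothesis c_ge2 : (2 <= c)%N.
Hypothesis c_max : (c <= maxn 2 (maxdeg d))%N.
Hypothesis driftS : a * m <= q.
Hypothesis c_q : c = 2%N \/ 59 / 3 * (c%:R - 2) * x <= q.
Hypothesis k_ge : 240 * (x / a) <= k%:R.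
Hypothesis k_le : k%:R <= 240 * (x / a) + 1.

Let r := x / a.

Lemma x_ge1 : 1 <= x.
Proof.
apply: le_trans dx; rewrite ler1n; apply: leq_trans (d_gt0 (Ordinal n_gt0)) _.
exact: leq_bigmax.
Qed.

Lemma d_lex v : (d v)%:R <= x.
Proof. by apply: le_trans dx; rewrite ler_nat leq_bigmax. Qed.

Lemma r_mul : r * a = x.
Proof. by rewrite /r divfK // gt_eqF. Qed.

Lemma x_le_r : x <= r.
Proof.
rewrite -[x in X in X <= _]r_mul ler_piMr // divr_ge0 ?ltW //.
by have := x_ge1; lra.
Qed.

Lemma n_le_m : n%:R <= m.
Proof.
rewrite /m /degsum ler_nat -[X in (X <= _)%N]card_ord -sum1_card.
by apply: leq_sum => v _.
Qed.

Lemma m_gt0 : 0 < m.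
Proof. by apply: lt_le_trans n_le_m; rewrite ltr0n. Qed.

Lemma q_le_m : q <= m.
Proof.
rewrite /q lerNl /drift /m /degsum natr_sum -sumrN.
rewrite [leRHS]big_mkcond /=; apply: ler_sum => v _.
have : 1 <= (d v)%:R :> K by rewrite ler1n.
case: ifP => _; last by lra.
have : 0 <= (d v)%:R * ((d v)%:R - 1) :> K.
  by rewrite mulr_ge0 // subr_ge0 ler1n.
by lra.
Qed.

(** Dividing [wx] by [a] gives [w * r <= a * n <= a * m <= q]: a large [w] makes every fixed
    multiple of [r] negligible against [q]. *)
Lemma wr_le_q : w * r <= q.
Proof.
apply: le_trans driftS.
apply: (@le_trans _ _ (a * n%:R)); last by rewrite ler_wpM2l ?(ltW a_gt0) ?n_le_m.
by rewrite -(ler_pM2r a_gt0) -mulrA r_mul; apply: le_trans wx _; lra.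
Qed.

Lemma q_pos : 0 < q.
Proof.
apply: lt_le_trans wr_le_q; rewrite mulr_gt0 //; first by have := w_large; lra.
by apply: lt_le_trans x_le_r; have := x_ge1; lra.
Qed.

Lemma cardS_le : #|S|%:R <= 21 * x.
Proof.
apply: le_trans weightS; rewrite ler_nat -sum1_card; apply: leq_sum => v _.
exact: d_gt0.
Qed.

Lemma c_le_2x : c%:R <= 2 * x.
Proof.
apply: (@le_trans _ _ (maxn 2 (maxdeg d))%:R); first by rewrite ler_nat.
have := x_ge1; rewrite /maxn; case: ifP => _; have := dx; lra.
Qed.

(** For [c >= 3], [c + c^2 <= 4c(c - 2) <= 4x(c - 2) <= (12/59) q], within [q / 4]; for [c = 2] the
    sum is 6, within [6 * r]. All multiples of [r] add up to [531 * r], below [q / 4] since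
    [w >= 8000]. *)
Lemma q_largeS : M%:R + (c + c * c + \sum_(s in S) d s)%:R <= q / 2.
Proof.
have cc : (c + c * c)%:R <= 6 * r + q / 4.
  have [xr x1] := (x_le_r, x_ge1).
  case: c_q => [->|cq]; first by have := q_pos; lra.
  have [->|c3] := eqVneq c 2%N; first by have := q_pos; lra.
  have {c3}c3 : (2 < c)%N by rewrite ltn_neqAle eq_sym c3.
  have cmax : (c <= maxdeg d)%N.
    by have := c_max; rewrite /maxn; case: ifP => // _; rewrite leqNgt c3.
  have cx : c%:R <= x by apply: le_trans dx; rewrite ler_nat.
  have c3' : 3 <= c%:R :> K by rewrite ler_nat.
  have : 0 <= (c%:R - 2) * (x - c%:R) by rewrite mulr_ge0 // subr_ge0 //; lra.
  have : 0 <= c%:R * (c%:R - 3) :> K by rewrite mulr_ge0 // subr_ge0 //; lra.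
  rewrite natrD natrM; nra.
have Mr : M%:R <= 504 * r.
  rewrite /M !natrD; have := cardS_le; have := k_le; rewrite -/r.
  by have := x_le_r; have := x_ge1; lra.
have wS : (\sum_(s in S) d s)%:R <= 21 * r.
  by apply: le_trans weightS _; have := x_le_r; lra.
rewrite [X in _ + X]natrD; have := wr_le_q.
have r0 : 0 <= r by have := x_le_r; have := x_ge1; lra.
have := ler_wpM2r r0 w_large.
by lra.
Qed.

Lemma potential0_le A : S \subset A -> weight K d A <= 22 * x ->
  potential d S kappa A finset.set0 <= 44 * x.
Proof.
move=> SA wA.
have open0 B : openings K d B finset.set0 = weight K d B.
  rewrite /openings /weight natr_sum; apply: eq_bigr => v _.
  rewrite (_ : degree _ v = 0%N) ?subr0 //; apply/eqP; rewrite cards_eq0.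
  by apply/eqP/setP => e; rewrite !inE.
rewrite /potential !open0.
have : kappa * weight K d S <= 1 * weight K d S.
  rewrite ler_wpM2r ?ler0n // /kappa ler_pdivrMr ?mul1r ?mulr_gt0 ?m_gt0 //.
  by have := q_le_m; have := m_gt0; lra.
have : weight K d S <= weight K d A.
  by rewrite ler_nat [leqRHS](big_setID S) /= (setIidPr SA) leq_addr.
by lra.
Qed.

Lemma kappa_k : 60 * x <= kappa * k%:R.
Proof.
apply: (@le_trans _ _ (kappa * (240 * r))); last first.
  by rewrite ler_wpM2l // /kappa divr_ge0 ?mulr_ge0 ?(ltW q_pos) ?(ltW m_gt0).
rewrite -r_mul /kappa.
have : a <= q / m by rewrite ler_pdivlMr ?m_gt0.
have -> : q / (4 * m) = q / m / 4 by field; rewrite gt_eqF // m_gt0.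
move=> aq; have : r * a <= r * (q / m).
  by rewrite ler_wpM2l //; have := x_le_r; have := x_ge1; lra.
by lra.
Qed.

(* The margin is 60 x - 44 x = 16 x. *)
Lemma heavy_escapes A (theta : K) : S \subset A -> weight K d A <= 22 * x ->
  (#|A| <= #|S| + 1)%N ->
  0 <= theta -> theta * (c%:R - 2) <= 1 / 2 -> theta * V <= q / 8 ->
  #|escapes d k A finset.set0|%:R <= N * expR (- (16 * theta * x)).
Proof.
move=> SA wA AS t0 t1 t2.
have q_def : \sum_(v in ~: S) (d v)%:R * ((d v)%:R - 2) = - q by rewrite /q opprK.
have AM : (#|A| + k <= M)%N by rewrite /M leq_add2r; apply: leq_trans AS (leq_addr _ _).
have := exponential_bound d_gt0 d_le q_def q_pos q_largeS erefl t0 t1 t2 SA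
  (explored0 A) AM.
rewrite extensions0 => /le_trans; apply; rewrite ler_wpM2l ?(ltW N_gt0) // ler_expR.
have := ler_wpM2l t0 (potential0_le SA wA); have := ler_wpM2l t0 kappa_k.
rewrite -/kappa; lra.
Qed.

Lemma weight_add v : weight K d (v |: S) <= 22 * x.
Proof.
case: (boolP (v \in S)) => vS.
  rewrite (setUidPr _) ?sub1set //; have := weightS; have := x_ge1; lra.
rewrite /weight big_setU1 //= natrD; have := weightS; have := d_lex v.
by rewrite /weight; lra.
Qed.

Lemma T_le : T%:R <= 263 * r.
Proof.
rewrite /T !natrD; have := cardS_le; have := k_le; rewrite -/r.
by have := x_le_r; have := x_ge1; lra.
Qed.

Lemma T_ge : 240 * r <= T%:R.
Proof. by apply: le_trans k_ge _; rewrite ler_nat leq_addl. Qed.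

Lemma unifprob_L1 (e : K) :
  #|[set G in realizations d | (T < L1 G)%N]|%:R <= e * N ->
  1 - e <= unifprob K d (fun G => (L1 G)%:R <= 263 * (x / a)).
Proof.
move=> TN; apply: unifprob_ge => //; apply: le_trans TN.
rewrite ler_nat; apply: subset_leq_card; apply/subsetP => G.
rewrite !in_set => /andP[-> /=]; rewrite -ltNge => LT.
by rewrite -(ltr_nat K); apply: le_lt_trans LT; exact: T_le.
Qed.

(** * Failure bounds for large and for bounded [y] *)

Let D : K := (maxdeg d)%:R * a + Rparam K d.
Let y : K := n%:R * a ^+ 2 / D.
Hypothesis hlog : D * ln y <= x * a.

Lemma V_le_R : V <= m * Rparam K d.
Proof.
rewrite /Rparam -/m mulrC divfK ?gt_eqF ?m_gt0 // /V big_mkcond /=.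
by apply: ler_sum => v _; case: ifP => // _; rewrite mulr_ge0 // sqr_ge0.
Qed.

Lemma maxdeg_ge1 : 1 <= (maxdeg d)%:R :> K.
Proof.
by rewrite ler1n; apply: leq_trans (d_gt0 (Ordinal n_gt0)) (leq_bigmax _).
Qed.

Lemma R_ge0 : 0 <= Rparam K d.
Proof.
rewrite /Rparam divr_ge0 ?ler0n // sumr_ge0 // => v _.
by rewrite mulr_ge0 // sqr_ge0.
Qed.

Lemma D_gt0 : 0 < D.
Proof.
rewrite ltr_wpDr ?R_ge0 // mulr_gt0 //.
by have := maxdeg_ge1; lra.
Qed.

Lemma failure_large_y (H : K) : 3 <= H -> H <= y ->
  1 - 2 / H <= unifprob K d (fun G => (L1 G)%:R <= 263 * (x / a)).
Proof.
move=> H3 Hy; apply: unifprob_L1.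
have [[D0 x1] xr] := (D_gt0, x_ge1, x_le_r).
have y0 : 0 < y by lra.
(* Both conditions on [theta] follow from [a * maxdeg d <= D] and [V <= m * D]. The exponent is then
   [16 * theta * x = 2 * x * a / D], at least [2 * ln y] by [hlog]. *)
pose theta := a / (8 * D).
have t0 : 0 <= theta by rewrite divr_ge0 ?mulr_ge0 ?(ltW a_gt0) ?(ltW D0).
have tD : theta * D = a / 8 by rewrite /theta; field; rewrite gt_eqF.
have cD : a * (c%:R - 2) <= D.
  have [->|c3] := eqVneq c 2%N; first by rewrite subrr mulr0 ltW.
  have {c3}c3 : (2 < c)%N by rewrite ltn_neqAle eq_sym c3.
  have cmax : (c <= maxdeg d)%N.
    by have := c_max; rewrite /maxn; case: ifP => // _; rewrite leqNgt c3.
  have : a * c%:R <= a * (maxdeg d)%:R by rewrite ler_wpM2l ?(ltW a_gt0) ?ler_nat.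
  by rewrite /D; have := R_ge0; have := a_gt0; lra.
have t1 : theta * (c%:R - 2) <= 1 / 2.
  have -> : theta * (c%:R - 2) = a * (c%:R - 2) / D / 8.
    by rewrite /theta; field; rewrite gt_eqF.
  have : a * (c%:R - 2) / D <= 1 by rewrite ler_pdivrMr // mul1r.
  by lra.
have t2 : theta * V <= q / 8.
  have : theta * V <= theta * (m * D).
    rewrite ler_wpM2l //; apply: le_trans V_le_R _; rewrite ler_wpM2l ?(ltW m_gt0) //.
    by rewrite /D lerDr mulr_ge0 // ltW.
  have -> : theta * (m * D) = a * m / 8 by rewrite mulrCA tD; ring.
  by have := driftS; lra.
have esc v : #|escapes d k (v |: S) finset.set0|%:R <= N * y ^- 2.
  have SvS : S \subset v |: S by exact: subsetUr.
  have vSS : (#|v |: S| <= #|S| + 1)%N by rewrite cardsU1 addnC leq_add2l leq_b1.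
  apply: le_trans (heavy_escapes SvS (weight_add v) vSS t0 t1 t2) _.
  rewrite ler_wpM2l ?(ltW N_gt0) // -[y]lnK ?posrE // -expRM_natl -expRN ler_expR lerN2.
  have : ln y <= x * a / D by rewrite ler_pdivlMr // mulrC.
  have -> : 16 * theta * x = 2 * (x * a / D) by rewrite /theta; field; rewrite gt_eqF.
  by lra.
(* From [exp (- t) >= 1 - t] at [t = ln y] and [y >= 3]. With [hlog] this gives [(2/3) D <= x a],
   hence [n = y D / a^2 <= (3/2) y r]. *)
have lny : 2 / 3 <= ln y.
  have := expR_ge1Dx (- ln y); rewrite expRN lnK ?posrE // => h.
  have : y^-1 <= 3^-1 by rewrite lef_pV2 ?posrE //; lra.
  by lra.
have nar : n%:R <= 3 / 2 * y * r.
  have Dx : 2 / 3 * D <= x * a.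
    by apply: le_trans hlog; rewrite mulrC ler_wpM2l ?(ltW D0).
  have yD : y * D = n%:R * a ^+ 2 by rewrite /y divfK // gt_eqF.
  have a2 : 0 < a ^+ 2 by rewrite exprn_gt0.
  rewrite -(ler_pM2r a2) -yD.
  have -> : 3 / 2 * y * r * a ^+ 2 = 3 / 2 * y * (x * a) by rewrite -r_mul; ring.
  have := ler_wpM2l (ltW y0) Dx; lra.
have r0 : 0 < r by lra.
have Tpos : 0 < T%:R :> K by apply: lt_le_trans T_ge; lra.
have main : T%:R * #|[set G in realizations d | (T < L1 G)%N]|%:R <= n%:R * (N * y ^- 2).
  rewrite -natrM; apply: le_trans (_ : (\sum_v #|escapes d k (v |: S) finset.set0|)%:R <= _).
    rewrite ler_nat; apply: leq_trans (L1_double_count _ _) _; apply: leq_sum => v _.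
    apply: subset_leq_card; apply/subsetP => G; rewrite !in_set => /andP[-> Tv].
    rewrite sub0set /=; apply: leq_ltn_trans (leq_trans Tv _); last first.
      by apply: subset_leq_card; apply: reach_mono; rewrite sub1set !inE eqxx.
    by rewrite /T leq_add2r cardsU1 addnC leq_add2l leq_b1.
  rewrite natr_sum; apply: le_trans (ler_sum _ (fun v _ => esc v)) _.
  by rewrite sumr_const card_ord mulr_natl.
rewrite -(ler_pM2l Tpos); apply: le_trans main _.
have yV : y ^- 2 = y^-1 * y^-1 by rewrite expr2 invfM.
have yH : y^-1 <= H^-1 by rewrite lef_pV2 ?posrE //; lra.
have yV0 : 0 < y^-1 by rewrite invr_gt0.
have Ny : 0 <= N * y ^- 2 by rewrite yV !mulr_ge0 ?(ltW N_gt0) ?(ltW yV0).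
apply: le_trans (ler_wpM2r Ny nar) _.
have -> : 3 / 2 * y * r * (N * y ^- 2) = 3 / 2 * r * N * y^-1.
  by rewrite yV; field; rewrite gt_eqF.
have rN : 0 <= r * N by rewrite mulr_ge0 ?(ltW r0) ?(ltW N_gt0).
apply: (@le_trans _ _ (3 / 2 * (r * N) * H^-1)).
  by have := ler_wpM2l rN yH; lra.
have HV : 0 <= H^-1 by rewrite invr_ge0; lra.
have := ler_wpM2r (mulr_ge0 HV (ltW N_gt0)) T_ge.
have := mulr_ge0 rN HV; lra.
Qed.

(** For degrees between 1 and [c], [(d - 2)^2 <= c d], and [c d^2 = c d (d - 2) + 2 c d]. The first
    part sums to [- c * q], which is negative. *)
Lemma V_le_c : V <= 2 * c%:R * m.
Proof.
apply: (@le_trans _ _ (c%:R * (- q) + 2 * c%:R * m)); last first.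
  by rewrite gerDr mulr_ge0_le0 // oppr_le0 ltW // q_pos.
rewrite {1}/q opprK /drift /V big_distrr /m /degsum natr_sum big_distrr /=.
rewrite big_mkcond [X in _ <= X + _]big_mkcond -big_split /=.
apply: ler_sum => v _; rewrite in_setC; case: ifP => [/d_le dc|_]; last first.
  by rewrite add0r !mulr_ge0.
have d1 : 1 <= (d v)%:R :> K by rewrite ler1n.
have {}dc : (d v)%:R <= c%:R :> K by rewrite ler_nat.
have c2 : 2 <= c%:R :> K by rewrite ler_nat.
rewrite [leRHS](_ : _ = (d v)%:R * (c%:R * (d v)%:R)); last by ring.
rewrite ler_wpM2l // expr2.
have : 0 <= (d v)%:R * (c%:R - (d v)%:R) :> K by rewrite mulr_ge0 // subr_ge0.
by lra.
Qed.

Lemma failure_small_y (H : K) : 3 <= H -> y <= H -> H * (21 * H + 5) <= w ->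
  1 - 2 / H <= unifprob K d (fun G => (L1 G)%:R <= 263 * (x / a)).
Proof.
move=> H3 yH Hw; apply: unifprob_L1.
have [[D0 x1] xr] := (D_gt0, x_ge1, x_le_r).
have [m0 q0] := (m_gt0, q_pos).
have r0 : 0 < r by lra.
have x0 : 0 < x by lra.
have H0 : 0 < H by lra.
have c2 : 2 <= c%:R :> K by rewrite ler_nat.
pose h := x ^+ 2 / m.
have hm : h * m = x ^+ 2 by rewrite /h divfK // gt_eqF.
(* The vertices of [S] contribute at most [21 x * x^2 / m], the others [V / m <= 2 c <= 4 x]. *)
have Rle : Rparam K d <= 21 * x * h + 4 * x.
  rewrite /Rparam -/m ler_pdivrMr // mulrDl.
  have -> : 21 * x * h * m = 21 * x * x ^+ 2 by rewrite -hm; ring.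
  rewrite (bigID (mem S)) /=; apply: lerD; last first.
    have -> : \sum_(v | v \notin S) (d v)%:R * ((d v)%:R - 2) ^+ 2 = V.
      by apply: eq_bigl => v; rewrite inE.
    apply: le_trans V_le_c _; rewrite ler_wpM2r ?(ltW m0) //.
    by have := c_le_2x; lra.
  apply: (@le_trans _ _ (weight K d S * x ^+ 2)); last first.
    by rewrite ler_wpM2r ?sqr_ge0.
  rewrite /weight natr_sum big_distrl; apply: ler_sum => v _.
  rewrite ler_wpM2l // -ler_sqrt ?sqr_ge0 // !sqrtr_sqr.
  have d1 : 1 <= (d v)%:R :> K by rewrite ler1n.
  have := d_lex v; rewrite (ger0_norm (ltW x0)) ler_norml; lra.
have na2 : n%:R * a ^+ 2 <= H * (x * (5 + 21 * h)).
  have yD : y * D = n%:R * a ^+ 2 by rewrite /y divfK // gt_eqF.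
  rewrite -yD; apply: le_trans (_ : H * D <= _).
    by rewrite ler_wpM2r // ltW.
  rewrite ler_wpM2l ?(ltW H0) // /D.
  have : (maxdeg d)%:R * a <= x * 1.
    by apply: ler_pM => //; rewrite ltW.
  by lra.
(* R is then at least of order n a^2, and only S can make it that large. *)
have hH : H <= h.
  have : x * w <= x * (H * (5 + 21 * h)).
    rewrite mulrC; apply: le_trans wx _; rewrite mulrC; apply: le_trans na2 _; lra.
  rewrite (ler_pM2l x0) => wh.
  have : H * (21 * H + 5) <= H * (5 + 21 * h) by exact: le_trans Hw wh.
  by rewrite (ler_pM2l H0); lra.
(* The square of [a * x] is [h * (a^2 * m)], where [h >= H] and [a^2 * m >= w * x >= w >= 4 * H]. *)
have ax : 2 * H <= a * x.
  rewrite -ler_sqr ?nnegrE; [|by rewrite mulr_ge0 ?(ltW H0)..|by rewrite mulr_ge0 ?(ltW a_gt0) ?(ltW x0)].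
  have -> : (a * x) ^+ 2 = h * (a ^+ 2 * m) by rewrite exprMn -hm; ring.
  apply: (@le_trans _ _ (H * w)).
    rewrite exprMn expr2 [leRHS]mulrC.
    have : 4 * H <= w by apply: le_trans Hw; nra.
    by move=> /(ler_wpM2r (ltW H0)); lra.
  apply: ler_pM => //; first exact: ltW.
    by have := w_large; lra.
  apply: (@le_trans _ _ (a ^+ 2 * n%:R)); last first.
    by rewrite ler_wpM2l ?sqr_ge0 ?n_le_m.
  apply: le_trans wx; rewrite ler_peMr //; have := w_large; lra.
have cm0 : 0 < c%:R * m by rewrite mulr_gt0 // ltr0n ltnW.
(* If [c = 2] this is [q >= a * m] with [a * x >= 2 * H]. If [c >= 3], then [q >= c * x], so the
   quotient is at least [x^2 / m = h]. *)
have zH : H <= q * x / (c%:R * m).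
  rewrite ler_pdivlMr //.
  have axm : 2 * H * m <= q * x.
    have := ler_wpM2r (ltW m0) ax; have := ler_wpM2r (ltW x0) driftS; lra.
  case: c_q => [->|cq]; first by lra.
  have [->|c3] := eqVneq c 2%N; first by lra.
  have {c3}c3 : 3 <= c%:R :> K by rewrite ler_nat ltn_neqAle eq_sym c3.
  have cx3 : c%:R * x <= q.
    apply: le_trans cq; rewrite ler_wpM2r ?(ltW x0) //; lra.
  have : H * m <= x ^+ 2 by rewrite -hm ler_wpM2r ?(ltW m0).
  have := ler_wpM2r (ltW x0) cx3.
  have c0 : 0 <= c%:R :> K by lra.
  move=> h1 /(ler_wpM2l c0); move: h1; rewrite expr2; lra.
(* Chosen so that [V_le_c] gives exactly [theta * V <= q / 8]. The exponent [16 * theta * x] is the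
   quotient just bounded by [H]. *)
pose theta := q / (16 * (c%:R * m)).
have t0 : 0 <= theta by rewrite divr_ge0 ?mulr_ge0 ?(ltW q0) ?(ltW cm0).
have t1 : theta * (c%:R - 2) <= 1 / 2.
  have c16 : 0 < 16 * (c%:R * m) by rewrite mulr_gt0.
  rewrite /theta mulrAC ler_pdivrMr //.
  have : q * (c%:R - 2) <= m * c%:R.
    by apply: ler_pM; rewrite ?q_le_m ?(ltW q0) //; lra.
  by move: cm0; lra.
have t2 : theta * V <= q / 8.
  apply: le_trans (ler_wpM2l t0 V_le_c) _.
  have -> : theta * (2 * c%:R * m) = q / 8; last by [].
  by rewrite /theta; field; rewrite !gt_eqF //; lra.
have SwS : weight K d S <= 22 * x by have := weightS; lra.
have SS1 : (#|S| <= #|S| + 1)%N by rewrite leq_addr.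
have escS := heavy_escapes (subxx S) SwS SS1 t0 t1 t2.
have escS' : #|escapes d k S finset.set0|%:R <= N * H^-1.
  apply: le_trans escS _; rewrite ler_wpM2l ?(ltW N_gt0) //.
  rewrite expRN lef_pV2 ?posrE ?expR_gt0 //; apply: le_trans zH _.
  have -> : q * x / (c%:R * m) = 16 * theta * x.
    by rewrite /theta; field; rewrite !gt_eqF //; lra.
  by apply: le_trans (expR_ge1Dx _); lra.
have q_def : \sum_(v in ~: S) (d v)%:R * ((d v)%:R - 2) = - q by rewrite /q opprK.
pose F v := fresh_escapes d (#|S| + k) k v S finset.set0.
have frv v : 60 * x * #|F v|%:R <= N * (d v)%:R.
  have SkM : (#|S| + k + 1 + k <= M)%N by rewrite /M -(addnA #|S|) (addnC k) addnA.
  have := fresh_bound d_gt0 d_le q_def q0 q_largeS erefl v (subxx S)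
    (explored0 S) SkM.
  rewrite extensions0; apply: le_trans.
  by rewrite ler_wpM2r ?kappa_k.
set R := realizations d :\: escapes d k S finset.set0.
have Tpos : 0 < T%:R :> K by apply: lt_le_trans T_ge; lra.
have main : T%:R * #|[set G in R | (T < L1 G)%N]|%:R <= \sum_v #|F v|%:R :> K.
  rewrite -natr_sum -natrM ler_nat; apply: leq_trans (L1_double_count _ _) _.
  apply: leq_sum => v _; apply: subset_leq_card; apply/subsetP => G.
  rewrite in_set /R in_setD => /andP[/andP[nesc GR] Tv].
  have GE : G \in extensions d finset.set0 by rewrite extensions0.
  move: nesc; rewrite in_set GE /= -leqNgt => Sk.
  rewrite in_set GE /= Sk /=; apply/andP; split; last first.
    by apply: leq_ltn_trans Tv; rewrite /T leq_add2r leq_addl.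
  (* If [v] were reached from [S], its component would lie in that of [S], which has at most
     [#|S| + k < T] vertices. *)
  apply: contraL Tv => vS; rewrite -leqNgt.
  apply: leq_trans (_ : #|S| + k <= _)%N; last first.
    by rewrite /T leq_add2r leq_addr.
  apply: leq_trans Sk; apply: subset_leq_card; apply/subsetP => z /reachP[_ /set1P-> vz].
  move/reachP: vS => [s sS sv]; apply/reachP; exists s => //.
  exact: connect_trans sv vz.
have sumF : 60 * x * \sum_v #|F v|%:R <= N * m.
  rewrite big_distrr /m /degsum natr_sum big_distrr /=.
  by apply: ler_sum => v _; exact: frv.
have fail2 : #|[set G in R | (T < L1 G)%N]|%:R <= N * H^-1.
  set X := #|_|%:R in main *; have X0 : 0 <= X by rewrite ler0n.
  rewrite ler_pdivlMr //.
  have h1 : x * (240 * r * X) <= N * m / 60.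
    have := ler_wpM2r X0 T_ge => h1.
    have := ler_wpM2l (ltW x0) (le_trans h1 main); lra.
  have h2 : x ^+ 2 * X <= N * m.
    have : x * x <= x * r by rewrite ler_wpM2l ?(ltW x0).
    move=> /(ler_wpM2r X0); rewrite expr2.
    have := mulr_ge0 (ltW N_gt0) (ltW m0); lra.
  have h3 : h * X <= N.
    by rewrite -(ler_pM2r m0) mulrAC hm.
  apply: le_trans h3; rewrite mulrC ler_wpM2r //.
apply: (@le_trans _ _ (N * H^-1 + N * H^-1)); last by lra.
apply: le_trans (lerD escS' fail2).
rewrite -natrD ler_nat; apply: leq_trans (leq_card_setU _ _).
apply: subset_leq_card; apply/subsetP => G; rewrite in_set => /andP[GR TG].
rewrite in_setU; case: (boolP (G \in escapes d k S finset.set0)) => //= nesc.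
by rewrite in_set /R in_setD nesc GR.
Qed.
End FixedSize.

(** * Assembly of the two cases and passage to the limit *)

Lemma unifprob_L1_ge (K : realType) (n : nat) (d : 'I_n -> nat) (x Q w H : K) :
  (0 < n)%N -> is_degree_sequence d -> graphical d -> subcritical d x Q ->
  3 * (mstar d)%:R <= x ->
  (let D := (maxdeg d)%:R * `|Q| + Rparam K d in
   D * ln (n%:R * Q ^+ 2 / D) <= x * `|Q|) ->
  w * x <= Q ^+ 2 * n%:R -> (maxdeg d)%:R <= x ->
  8000 <= w -> 3 <= H -> H * (21 * H + 5) <= w ->
  1 - 2 / H <= unifprob K d (fun G => (L1 G)%:R <= 263 * (x / `|Q|)) <= 1.
Proof.
move=> n0 [d0 _ _] [G GR] [x0 Q0 [B [wB dB]]] mx hlog wx dx w8 H3 Hw.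
have N0 : 0 < (#|realizations d|)%:R :> K.
  by rewrite ltr0n; apply/card_gt0P; exists G.
rewrite unifprob_le1 // andbT.
have x1 : 1 <= x by exact: (x_ge1 n0 d0 dx).
have m0 : 0 < (degsum d)%:R :> K.
  by apply: lt_le_trans (n_le_m K d0); rewrite ltr0n.
have Qlt : 0 < `|Q|.
  (* If [Q = 0], then [w * x <= 0], although [x >= 1] and [w >= 8000]. *)
  rewrite normr_gt0; apply/eqP => Qz; move: wx; rewrite Qz expr0n /= mul0r.
  have := ler_wpM2r x0 w8; lra.
have QN : Q = - `|Q| by rewrite ler0_norm ?opprK.
have Q2 : `|Q| ^+ 2 = Q ^+ 2 by rewrite real_normK ?num_real.
have dB' : drift K d (~: B) <= - (`|Q| * (degsum d)%:R).
  by move: dB; rewrite excessE ler_pdivrMr // {1}QN mulNr.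
have Qle1 : `|Q| <= 1.
  rewrite -(ler_pM2r m0) mul1r; apply: le_trans (q_le_m K B d0).
  by rewrite lerNr.
have [S [c [wS dc /andP[c2 cmax] dS cq]]] :=
  heavy_set x0 dx mx (ex_intro _ B (conj wB dB')).
have r0 : 0 <= 240 * (x / `|Q|) by rewrite mulr_ge0 // divr_ge0.
have [k [k1 k2]] : exists k : nat,
    240 * (x / `|Q|) <= k%:R /\ k%:R <= 240 * (x / `|Q|) + 1.
  have /andP[t1 t2] := truncn_itv r0.
  by exists (Num.truncn (240 * (x / `|Q|))).+1; rewrite ltW // -natr1 lerD2r.
have dS' : `|Q| * (degsum d)%:R <= - drift K d (~: S) by rewrite lerNr.
rewrite -Q2 in wx; rewrite /= -Q2 in hlog.
have [yH|Hy] := leP (n%:R * `|Q| ^+ 2 /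
    ((maxdeg d)%:R * `|Q| + Rparam K d)) H.
  exact: (failure_small_y n0 d0 N0 Qlt Qle1 dx wx w8 wS dc c2 cmax dS' cq k1 k2).
exact: (failure_large_y n0 d0 N0 Qlt Qle1 dx wx w8 wS dc c2 cmax dS' cq k1 k2
  hlog H3 (ltW Hy)).
Qed.

Local Open Scope classical_set_scope.

Theorem theorem1p8 (K : realType) (d : forall n : nat, 'I_n -> nat)
  (m0 Q0 omega : nat -> K)
  (hdeg : \forall n \near \oo, is_degree_sequence (d n))
  (hgraph : \forall n \near \oo, graphical (d n))
  (hsub : \forall n \near \oo, subcritical (d n) (m0 n) (Q0 n))
  (hstar : \forall n \near \oo, 3 * (mstar (d n))%:R <= m0 n)
  (hlog : \forall n \near \oo,
     let D := (maxdeg (d n))%:R * `|Q0 n| + Rparam K (d n) in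
     D * ln (n%:R * Q0 n ^+ 2 / D) <= m0 n * `|Q0 n|)
  (homega : omega @ \oo --> +oo)
  (hQ : \forall n \near \oo, omega n * m0 n <= Q0 n ^+ 2 * n%:R)
  (* Excludes only degenerate parameters: it follows from hstar when S_* is
     not empty, and from hlog when the argument of ln is at least e. *)
  (hmax : \forall n \near \oo, (maxdeg (d n))%:R <= m0 n) :
  exists2 C : K, 0 < C &
    (fun n => unifprob K (d n)
       (fun G => (L1 G)%:R <= C * (m0 n / `|Q0 n|))) @ \oo --> (1 : K).
Proof.
(* The constant comes from [T = #|S| + 1 + k <= 21 x + 1 + (240 r + 1) <= 263 r], with
   [1 <= x <= r]. *)
exists 263 => //; apply/cvgrPdist_lt => e e0.
(* Since [e * H = 3 * e + 2 > 2], the failure bound [2 / H] is below [e], while [H] does not depend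
   on [n] and is eventually dominated by [omega]. *)
pose H : K := 3 + 2 / e.
have eV : 0 < 2 / e by rewrite divr_gt0.
have H3 : 3 <= H by rewrite /H; lra.
have He : 2 / H < e.
  rewrite ltr_pdivrMr; last by lra.
  by rewrite /H mulrDr (mulrCA e) divff ?gt_eqF // mulr1; lra.
have w8 : \forall n \near \oo, 8000 <= omega n by move/cvgryPge : homega; exact.
have wH : \forall n \near \oo, H * (21 * H + 5) <= omega n.
  by move/cvgryPge : homega; exact.
near=> n.
have n0 : (0 < n)%N by near: n; exact: nbhs_infty_gt.
have : 1 - 2 / H <= unifprob K (d n)
    (fun G => (L1 G)%:R <= 263 * (m0 n / `|Q0 n|)) <= 1.
  by apply: (@unifprob_L1_ge K n (d n) (m0 n) (Q0 n) (omega n) H) => //; near: n.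
move=> /andP[h1 h2]; rewrite ger0_norm ?subr_ge0 //; lra.
Unshelve. all: by end_near.
Qed.
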